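(* Every Wilton number is a Lebesgue point of $\mathcal{W}$. In particular, $\Upsilon$ is differentiable at every Wilton number $x\in(0,1)$, and $\Upsilon'(x)=\mathcal{W}(x)$.
   Context: $\{t\}$ is the fractional part of $t$. For $x\in X=(0,1)\setminus\mathbb{Q}$ put $\alpha(x)=\{1/x\}$, $\alpha_0(x)=x$, $\alpha_k(x)=\alpha(\alpha_{k-1}(x))$ for $k\ge1$, $\beta_{-1}=1$, $\beta_k(x)=\alpha_0(x)\cdots\alpha_k(x)$, $\gamma_k(x)=\beta_{k-1}(x)\log(1/\alpha_k(x))$, and consider the series $\mathcal{W}(x)=\sum_{k\ge0}(-1)^k\gamma_k(x)$, extended to all irrational $x\in\mathbb{R}$ by $\mathcal{W}(x)=\mathcal{W}(\{x\})$. It converges almost everywhere and defines a function integrable on $[0,1]$. An irrational number $x$ is a Wilton number if the series $\mathcal{W}(x)$ converges. $\Upsilon(x)=\int_0^x\mathcal{W}(t)\,dt$ for $0\le x\le1$. A point $x$ is a Lebesgue point of a locally integrable function $f$ (defined at $x$) if $\lim_{h\to0}\frac1h\int_x^{x+h}|f(t)-f(x)|\,dt=0$. *)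

(* Defs.v *)
From mathcomp Require Export all_boot all_order all_algebra.
From mathcomp Require Export all_classical all_reals all_analysis.
Set Implicit Arguments.
Unset Strict Implicit.
Unset Printing Implicit Defensive.
Import Order.TTheory GRing.Theory Num.Theory.
Import numFieldNormedType.Exports.
Local Open Scope classical_set_scope.
Local Open Scope ring_scope.

Definition frac_part (R : realType) (t : R) : R := t - (Num.floor t)%:~R.

Definition gauss_map (R : realType) (x : R) : R := frac_part x^-1.

(* The functions below are meant for irrational x in (0,1); the conventions
   0^-1 = 0 and ln y = 0 for y <= 0 make them total. *)
Definition alpha (R : realType) (k : nat) (x : R) : R :=
  iter k (@gauss_map R) x.

(* Shifted index: [beta_pred k] is beta_{k-1}, so that [beta_pred 0] is
   beta_{-1} = 1. *)
Definition beta_pred (R : realType) (k : nat) (x : R) : R :=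
  \prod_(j < k) alpha j x.

Definition wgamma (R : realType) (k : nat) (x : R) : R :=
  beta_pred k x * ln (alpha k x)^-1.

Definition wilton_series (R : realType) (x : R) : R^nat :=
  series (fun k => (-1) ^+ k * wgamma k (frac_part x)).

Definition wilton_number (R : realType) : set R :=
  [set x | @irrational R x /\ cvgn (wilton_series x)].

(* The Wilton function is only defined at the Wilton numbers, which have full
   measure; the total function below is extended by 0. *)
Definition wilton (R : realType) (x : R) : R :=
  if x \in @wilton_number R then limn (wilton_series x) else 0.

(* Oriented integral from a to b, so that limits as h -> 0 of integrals from x
   to x + h can be two-sided. *)
Definition oriented_integral (R : realType) (f : R -> R) (a b : R) : R :=
  if a <= b then Rintegral (@lebesgue_measure R) `[a, b] f
  else - Rintegral (@lebesgue_measure R) `[b, a] f.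

(* [Rintegral] is 0 on an infinite integral; local integrability excludes this
   case. The library's [lebesgue_pt] uses averages over balls centred at x
   instead of over the intervals between x and x + h. *)
Definition lebesgue_point (R : realType) (f : R -> R) (x : R) : Prop :=
  locally_integrable setT f /\
  h^-1 * oriented_integral (fun t => `|f t - f x|) x (x + h) @[h --> 0^']
    --> (0 : R).

(* Only the values on [0, 1] matter. *)
Definition Upsilon (R : realType) (x : R) : R :=
  oriented_integral (@wilton R) 0 x.

(* Main.v *)
Require Import Defs.
From mathcomp Require Import all_boot all_order all_algebra.
From mathcomp Require Import all_classical all_reals all_analysis.
From mathcomp Require Import measurable_realfun ring lra.
Import Order.TTheory GRing.Theory Num.Theory.
Import numFieldNormedType.Exports.
Local Open Scope classical_set_scope.
Local Open Scope ring_scope.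

(** Put [W] for the Wilton function, [gamma_k] for the terms of its series
    without their signs, [S_n] for the sum of the first [n] terms and [q_n] for
    the denominators of the convergents of [x].  The points whose first [n]
    partial quotients are those of [x] form an interval, the cell of depth [n]
    around [x].  On it every [beta_k] with [k <= n] is an affine function
    [(-1)^k (q_k t - p_k)] of [t], and [alpha_n] is the quotient of two
    consecutive ones.

    Let [I] be an interval of length [h] with [x] in it, contained in the cell
    of depth [n] but not in the cell of depth [n+1].  As [h] tends to [0], [n]
    tends to infinity, so it suffices to bound the mean of [|W - W(x)|] over [I]
    by a quantity that tends to [0] with [n].  For almost every [t],

      [|W(t) - W(x)| <= |W(x) - S_(n+1)(x)|
           + sum_(k < n) |gamma_k(t) - gamma_k(x)|
           + gamma_n(x) + gamma_n(t) + sum_(k > n) gamma_k(t)].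

    - The first and third terms tend to [0] since the series converges at [x].
    - For [k < n] the affine formulas give [gamma_k] a Lipschitz constant of
      order [q_(k+1)] on the cell ([wgamma_lipschitz]); as the [q_k] grow at
      least geometrically and [h <= 1 / q_n^2], these terms add up to
      [O(1 / q_n)].
    - For [k >= n] the function [alpha_k] is nearly equidistributed on a cell of
      depth [n]: the proportion of the points with [alpha_k < s] is at most
      [2 s] ([alpha_lt_measure]).  With [D] the length of the cell, the mean of
      [ln (1 / alpha_k)] over [I] is thus at most [ln (D / h) + 4]
      ([integral_ln_alpha] with [exp (- lam) = h / D]).  Since
      [alpha_j alpha_(j+1) <= 1/2], the factors [beta_(k-1)] decrease
      geometrically in [k], so the mean of [sum_(k > n) gamma_k] over [I] is of
      order [(beta_n(x) + q_n h) (ln (D / h) + 4)].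
    - The maximality of [n] bounds [ln (D / h)].  The interval [I] contains an
      endpoint of the cell of depth [n+1], so [h] is at least the distance from
      [x] to it, which is small compared with the cell only if [alpha_(n+1)(x)] is
      near [0] or near [1]; in the latter case [alpha_(n+2)(x)] is near [0].  This makes
      [beta_n(x) ln (D / h)] of order
      [1 / q_n + gamma_(n+1)(x) + gamma_(n+2)(x)] ([escape_bound]).

    All these quantities tend to [0] because the terms of a convergent series
    do.  The estimate on a cell of depth [0] also shows that the sum of the
    [gamma_k] has a finite integral over bounded intervals, whence the almost
    everywhere convergence of the series and the local integrability of [W]. *)

(** * Iterates of the Gauss map *)

Arguments alpha : simpl never.

Section gauss_iterates.
Context {R : realType}.
Implicit Types (x t u : R) (k n m : nat).

Lemma frac_part_itv t : 0 <= frac_part t < 1.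
Proof.
have := floor_itv t; rewrite intrD => /andP[h1 h2].
by rewrite /frac_part; apply/andP; split; lra.
Qed.

Lemma frac_partP (i : int) t : 0 <= t - i%:~R < 1 -> frac_part t = t - i%:~R.
Proof.
move=> /andP[h1 h2]; rewrite /frac_part (@floor_def _ _ i)//.
by rewrite intrD; apply/andP; split; lra.
Qed.

Lemma alphaS k x : alpha k.+1 x = frac_part (alpha k x)^-1.
Proof. by []. Qed.

Lemma alpha_itv k t : 0 <= alpha k (frac_part t) < 1.
Proof. by case: k => [|k]; exact: frac_part_itv. Qed.

(** The value [0] is absorbing for the Gauss map. *)
Lemma alpha_neq0_of_later_gt0 k n x :
  0 < alpha (k + n) x -> alpha k x != 0.
Proof.
apply: contraTN => /eqP k0; rewrite -leNgt.
suff -> : alpha (k + n) x = 0 by [].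
elim: n => [|n IH]; first by rewrite addn0.
by rewrite addnS alphaS IH invr0 /frac_part floor0 subr0.
Qed.

(** With [a = alpha k], the product is [1 - floor (1/a) * a], and [floor (1/a)] is at
    least half of [1/a] because [1/a > 1]. *)
Lemma alpha_mulS_le k t :
  alpha k (frac_part t) * alpha k.+1 (frac_part t) <= 2^-1.
Proof.
have /andP[] := alpha_itv k t; set a := alpha k _ => a0 a1.
rewrite alphaS -/a.
have [->|an0] := eqVneq a 0; first by rewrite mul0r invr_ge0.
have ap : 0 < a by rewrite lt_neqAle eq_sym an0.
have /andP[h1 h2] := floor_itv a^-1.
have f1 : (1 : R) <= (Num.floor a^-1)%:~R.
  rewrite ler1z -gtz0_ge1 floor_gt0.
  by rewrite invf_ge1 ?ltW.
rewrite /frac_part mulrBr divff//.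
move: h1 h2; rewrite intrD; set i := _%:~R in f1 *; move=> h1 h2.
have : a * a^-1 <= a * (i + 1) by rewrite ler_pM2l// ltW.
rewrite divff//; nra.
Qed.

Lemma beta_predS k x : beta_pred k.+1 x = beta_pred k x * alpha k x.
Proof. by rewrite /beta_pred big_ord_recr. Qed.

Lemma beta_pred_ge0 k t : 0 <= beta_pred k (frac_part t).
Proof. by apply: prodr_ge0 => i _; have /andP[] := alpha_itv i t. Qed.

(** The ratio [3/4] satisfies [(3/4)^2 >= 1/2], so that it absorbs the factor [1/2]
    won every second step, and the constant [2] covers an odd number of steps. *)
Lemma beta_pred_geometric n m t :
  beta_pred (n + m) (frac_part t) <=
  beta_pred n (frac_part t) * (2 * (3/4) ^+ m).
Proof.
have b0 := beta_pred_ge0.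
have step k : beta_pred k.+2 (frac_part t) <= beta_pred k (frac_part t) * 2^-1.
  by rewrite !beta_predS -mulrA ler_wpM2l// alpha_mulS_le.
have : beta_pred (n + m) (frac_part t) <=
    beta_pred n (frac_part t) * (2 * (3/4) ^+ m) /\
  beta_pred (n + m.+1) (frac_part t) <=
    beta_pred n (frac_part t) * (2 * (3/4) ^+ m.+1).
  elim: m => [|m [IH1 IH2]].
    rewrite addn0 addn1 expr0 expr1; split.
      by rewrite ler_peMr//; lra.
    rewrite beta_predS ler_wpM2l//.
    have /andP[_ /ltW h] := alpha_itv n t; apply: (le_trans h); clear; lra.
  split => //; rewrite !addnS; apply: (le_trans (step _)).
  have := ler_wpM2r (_ : 0 <= 2^-1 :> R) IH1; move/(_ ltac:(lra)).
  move/le_trans; apply; rewrite -!mulrA ler_wpM2l// !exprS.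
  have : 0 <= (3/4 : R) ^+ m by rewrite exprn_ge0.
  by set z := _ ^+ m; lra.
by case.
Qed.

Lemma ln_invr_alpha_ge0 k t : 0 <= ln (alpha k (frac_part t))^-1.
Proof.
have /andP[] := alpha_itv k t; set a := alpha k _ => a0 a1.
have [->|an0] := eqVneq a 0; first by rewrite invr0 ln0.
by apply: ln_ge0; rewrite invf_ge1 1?ltW// lt_neqAle eq_sym an0.
Qed.

Lemma wgamma_ge0 k t : 0 <= wgamma k (frac_part t).
Proof. by rewrite mulr_ge0 ?beta_pred_ge0 ?ln_invr_alpha_ge0. Qed.

End gauss_iterates.

(** * Cells of the continued fraction expansion *)

(** The cylinder set of a word of [n] partial quotients is encoded by [q_(n-1)] and
    [q_n] and by [beta_(n-1)] and [beta_n] as functions of the point.  These two are kept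
    as the affine functions [(-1)^k (q_k t - p_k)], which make sense on the whole line
    and not only on the cylinder. *)
Record cell (R : realType) := Cell {
  cden_prev : R ; cden : R ; crem_prev : R -> R ; crem : R -> R }.
Arguments Cell {R}.
Arguments cden_prev {R}. Arguments cden {R}.
Arguments crem_prev {R}. Arguments crem {R}.

Section cells.
Context {R : realType}.
Implicit Types (c : cell R) (n a : nat) (t : R).

Definition cset c : set R := [set t | 0 < crem c t < crem_prev c t].

Definition clen c : R := (cden c * (cden c + cden_prev c))^-1.

(** The fractional part of [t] is [t - i] on the open interval from [i] to [i + 1];
    keeping the integer part in the cell makes translations superfluous. *)
Definition root_cell (i : int) : cell R :=
  Cell 0 1 (fun=> 1) (fun t => t - i%:~R).

Definition child c (a : nat) : cell R :=
  Cell (cden c) (a%:R * cden c + cden_prev c)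
       (crem c) (fun t => crem_prev c t - a%:R * crem c t).

(** The invariants of a cylinder of depth [n].  The identity [crem_det] is the
    determinant identity for consecutive convergents, in the form
    [q_n beta_(n-1) + q_(n-1) beta_n = 1]. *)
Record is_cell n c : Prop := IsCell {
  cden_prev_ge0 : 0 <= cden_prev c ;
  cden_prev_le : cden_prev c <= cden c ;
  cden_ge1 : 1 <= cden c ;
  crem_affine : exists e p : R, e ^+ 2 = 1 /\
    forall t, crem c t = e * (cden c * t - p) ;
  crem_det : forall t, cden c * crem_prev c t + cden_prev c * crem c t = 1 ;
  alpha_cell : forall t, cset c t ->
    alpha n (frac_part t) = crem c t / crem_prev c t ;
  beta_pred_cell : forall t, cset c t -> beta_pred n (frac_part t) = crem_prev c t
}.

Lemma root_cellP i : is_cell 0 (root_cell i).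
Proof.
split => //=; first by exists 1, i%:~R; split => [|t]; rewrite ?expr1n// !mul1r.
- by move=> t; ring.
- move=> t /andP[h1 h2]; rewrite divr1; apply: frac_partP.
  by rewrite h2 andbT ltW.
- by move=> t _; rewrite /beta_pred big_ord0.
Qed.

Lemma cset_child_sub c a : (0 < a)%N -> cset (child c a) `<=` cset c.
Proof.
move=> a0 t /andP[/=]; rewrite /cset/= => h1 h2.
have a1 : 1 <= a%:R :> R by rewrite ler1n.
by apply/andP; split; nra.
Qed.

(** The determinant identity expresses [crem_prev] by [crem], which gives the next
    remainder its affine form with slope of the opposite sign. *)
Lemma childP n c a : (0 < a)%N -> is_cell n c -> is_cell n.+1 (child c a).
Proof.
move=> a0 [q'0 q'q q1 [e [p [e2 crE]]] det aE bE].
have a1 : 1 <= a%:R :> R by rewrite ler1n.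
have q0 : cden c != 0 by lra.
have b'E t : crem_prev c t = (1 - cden_prev c * crem c t) / cden c.
  by rewrite -[X in X - _](det t) addrK mulrC mulKf.
split => //=.
- lra.
- nra.
- nra.
- exists (- e), (e / cden c + (a%:R * cden c + cden_prev c) * p / cden c).
  split; first by rewrite sqrrN.
  move=> t; rewrite b'E crE.
  by rewrite -{1}e2; field.
- by move=> t; rewrite -(det t); ring.
- move=> t ct; have := cset_child_sub c a a0 t ct; move=> ct'.
  move: ct (ct') => /andP[/= h1 h2] /andP[h3 h4].
  rewrite alphaS (aE _ ct') invf_div (@frac_partP _ a).
    by rewrite mulrBl mulfK// gt_eqF.
  rewrite -[a%:~R]/(a%:R : R) subr_ge0 ltrBlDr ler_pdivlMr// ltr_pdivrMr//.
  by apply/andP; split; lra.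
- move=> t ct; have ct' := cset_child_sub c a a0 t ct.
  rewrite beta_predS (aE _ ct') (bE _ ct') mulrC divfK//.
  by move: ct' => /andP[h1 h2]; rewrite gt_eqF// (lt_trans h1).
Qed.

Lemma cset_child_disjoint c a1 a2 t :
  cset (child c a1) t -> cset (child c a2) t -> a1 = a2.
Proof.
have H b1 b2 : cset (child c b1) t -> cset (child c b2) t -> (b1 <= b2)%N.
  move=> /andP[/= h1 h2] /andP[/= h3 h4]; rewrite leqNgt; apply/negP => h.
  have : b2%:R + 1 <= b1%:R :> R by rewrite natr1 ler_nat.
  by set x := _%:R in h1 h2 *; set y := _%:R in h3 h4 *; nra.
by move=> h1 h2; apply/eqP; rewrite eqn_leq !H.
Qed.

(** The first partial quotient of [t] beyond those of [c] is the integer part of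
    [crem_prev / crem]; the point is interior to its child unless that ratio is an
    integer. *)
Lemma cset_childP n c t : is_cell n c -> cset c t ->
  alpha n.+1 (frac_part t) != 0 ->
  (0 < Num.truncn (alpha n (frac_part t))^-1)%N /\
  cset (child c (Num.truncn (alpha n (frac_part t))^-1)) t.
Proof.
move=> [_ _ _ _ _ aE _] ct; rewrite alphaS (aE _ ct) invf_div.
move: (ct) => /andP[h1 h2].
set y := _ / _ => fy.
have y1 : 1 < y by rewrite /y ltr_pdivlMr// mul1r.
have y0 : 0 <= y by lra.
have /andP[t1 t2] := truncn_itv y0.
split; first by rewrite truncn_gt0 ltW.
have E : crem_prev c t = y * crem c t by rewrite /y divfK// gt_eqF.
have {}fy : y - (Num.truncn y)%:R != 0.
  apply: contra_neq fy => fy0; rewrite (@frac_partP _ (Num.truncn y))//.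
  by rewrite -[_%:~R]/(_%:R : R) fy0 lexx ltr01.
have {fy t1}t1 : (Num.truncn y)%:R < y.
  by rewrite lt_neqAle t1 andbT -subr_eq0 -oppr_eq0 opprB.
rewrite -natr1 in t2.
rewrite /cset/= E; set k := _%:R in t1 t2 *.
by apply/andP; split; nra.
Qed.

End cells.

(** * Measurability of the terms of the series *)

Section measurability.
Context {R : realType}.

Lemma measurable_floorR : measurable_fun setT (fun t : R => (Num.floor t)%:~R : R).
Proof.
apply: nondecreasing_measurable => // x y xy.
by rewrite ler_int le_floor.
Qed.

Lemma measurable_frac_part : measurable_fun setT (@frac_part R).
Proof. by apply: measurable_funB => //; exact: measurable_floorR. Qed.

Lemma measurable_alpha_frac k :
  measurable_fun setT (fun t : R => alpha k (frac_part t)).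
Proof.
elim: k => [|k IH]; first exact: measurable_frac_part.
(* For [y > 0] the inverse of [y] is [expR (- ln y)], a measurable function of [y]. *)
pose f t := if 0 < alpha k (frac_part t)
  then expR (- ln (alpha k (frac_part t))) else 0 : R.
rewrite (_ : (fun _ => _) = @frac_part R \o f); last first.
  apply/funext => t; rewrite alphaS /f /=; case: ifPn => h.
    by rewrite expRN lnK.
  have /andP[a0 _] := alpha_itv k t.
  suff -> : alpha k (frac_part t) = 0 by rewrite invr0.
  by apply/eqP; rewrite eq_le a0 leNgt h.
apply: (measurableT_comp measurable_frac_part).
apply: measurable_fun_ifT => //; first exact: measurable_fun_ltr.
apply: measurableT_comp => //; apply: measurable_funN.
exact: measurableT_comp.
Qed.

Lemma measurable_ln_invr_alpha k :
  measurable_fun setT (fun t : R => ln (alpha k (frac_part t))^-1).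
Proof.
rewrite (_ : (fun _ => _) = fun t => - ln (alpha k (frac_part t))).
  apply: measurable_funN; apply: measurableT_comp => //.
  exact: measurable_alpha_frac.
apply/funext => t; have /andP[] := alpha_itv k t; rewrite le_eqVlt.
move=> /predU1P[<- _|a0 _]; last by rewrite lnV.
by rewrite invr0 ln0// oppr0.
Qed.

Lemma measurable_beta_pred k :
  measurable_fun setT (fun t : R => beta_pred k (frac_part t)).
Proof.
elim: k => [|k IH].
  rewrite (_ : (fun _ => _) = cst 1)//.
  by apply/funext => t; rewrite /beta_pred big_ord0.
rewrite (_ : (fun _ => _) = fun t =>
  beta_pred k (frac_part t) * alpha k (frac_part t)); last first.
  by apply/funext => t; rewrite beta_predS.
by apply: measurable_funM => //; exact: measurable_alpha_frac.
Qed.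

Lemma measurable_wgamma k :
  measurable_fun setT (fun t : R => wgamma k (frac_part t)).
Proof.
by apply: measurable_funM;
  [exact: measurable_beta_pred|exact: measurable_ln_invr_alpha].
Qed.

End measurability.

(** * Distribution of the iterates on a cell *)

Section cell_measure.
Context {R : realType}.
Local Notation mu := (@lebesgue_measure R).
Implicit Types (c : cell R) (s : R).

Lemma affine_slab (e q p d : R) : e ^+ 2 = 1 -> 0 < q -> 0 <= d ->
  exists2 i : interval R, [set t | 0 < e * (q * t - p) < d] = [set` i] &
    mu [set` i] = (d / q)%:E.
Proof.
move=> /eqP; rewrite sqrf_eq1 => /orP[] /eqP -> q0 d0.
- exists `](p / q), ((p + d) / q)[; last first.
    rewrite lebesgue_measure_itv/= lte_fin ltr_pM2r ?invr_gt0//.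
    case: ltP => h; first by rewrite -EFinD; congr EFin; field; rewrite gt_eqF.
    have -> : d = 0 by lra.
    by rewrite mul0r.
  apply/seteqP; split => t /=; rewrite in_itv/= ltr_pdivrMr// ltr_pdivlMr//;
    by move=> /andP[h1 h2]; apply/andP; split; lra.
- exists `]((p - d) / q), (p / q)[; last first.
    rewrite lebesgue_measure_itv/= lte_fin ltr_pM2r ?invr_gt0//.
    case: ltP => h; first by rewrite -EFinD; congr EFin; field; rewrite gt_eqF.
    have -> : d = 0 by lra.
    by rewrite mul0r.
  apply/seteqP; split => t /=; rewrite in_itv/= ltr_pdivrMr// ltr_pdivlMr//;
    by move=> /andP[h1 h2]; apply/andP; split; lra.
Qed.

Lemma cden_gt0 n c : is_cell n c -> 0 < cden c.
Proof. by move=> h; apply: lt_le_trans (cden_ge1 _ _ h). Qed.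

Lemma clen_gt0 n c : is_cell n c -> 0 < clen c.
Proof.
by move=> h; rewrite invr_gt0 mulr_gt0 ?(cden_gt0 _ _ h)// ltr_pwDl
  ?(cden_gt0 _ _ h)// (cden_prev_ge0 _ _ h).
Qed.

(** By the determinant identity, [crem < crem_prev] is a bound on [crem] alone. *)
Lemma cset_slab n c : is_cell n c ->
  cset c = [set t | 0 < crem c t < (cden c + cden_prev c)^-1].
Proof.
move=> H; have [q'0 q'q q1 _ det _ _] := H.
apply/seteqP; split => t /=; have := det t => dt.
- move=> /andP[h1 h2]; rewrite h1/= -[ltRHS]mul1r ltr_pdivlMr; nra.
- move=> /andP[h1]; rewrite -[X in _ < X -> _]mul1r ltr_pdivlMr; last nra.
  by move=> h2; apply/andP; split => //; nra.
Qed.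

Lemma cset_itv n c : is_cell n c ->
  exists2 i : interval R, cset c = [set` i] & mu [set` i] = (clen c)%:E.
Proof.
move=> H; rewrite (cset_slab _ _ H); have [q'0 q'q q1 [e [p [e2 crE]]] _ _ _] := H.
have [//||i iE mui] := affine_slab e (cden c) p (cden c + cden_prev c)^-1 e2.
- lra.
- by rewrite invr_ge0; lra.
exists i; last by rewrite mui /clen; congr EFin; field; rewrite !gt_eqF//; lra.
by rewrite -iE; apply/seteqP; split => t /=; rewrite crE.
Qed.

Lemma measurable_cset n c : is_cell n c -> measurable (cset c).
Proof. by case/cset_itv => i -> _; exact: measurable_itv. Qed.

Lemma lebesgue_measure_cset n c : is_cell n c -> mu (cset c) = (clen c)%:E.
Proof. by case/cset_itv => i ->. Qed.

Lemma measurable_alpha_lt k s :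
  measurable [set t : R | 0 < alpha k (frac_part t) < s].
Proof.
rewrite (_ : [set _ | _] = (fun t : R => alpha k (frac_part t)) @^-1` `]0, s[).
  by rewrite -[X in measurable X]setTI; apply: measurable_alpha_frac.
by apply/seteqP; split => t /=; rewrite in_itv.
Qed.

(** On a cell of depth [n], [alpha_n] is a quotient of affine functions and the set is
    an interval; for a later iterate, sum over the children, which are disjoint.
    The condition [0 < alpha] removes the rational points outside of all children;
    nothing is lost, as [ln (1 / alpha)] is [0] there by convention. *)
Lemma alpha_lt_measure m n c s : is_cell n c -> 0 <= s ->
  (mu (cset c `&` [set t | (0 < alpha (n + m) (frac_part t) < s)%R])
   <= (2 * s)%:E * mu (cset c))%E.
Proof.
elim: m n c => [|m IH] n c H s0.
- rewrite addn0; have [q'0 q'q q1 [e [p [e2 crE]]] det aE _] := H.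
  have [//||i iE mui] := affine_slab e (cden c) p (s / cden c) e2.
  + lra.
  + by rewrite divr_ge0//; lra.
  have sub : cset c `&` [set t | 0 < alpha n (frac_part t) < s] `<=` [set` i].
    rewrite -iE => t [ct /=]; rewrite aE//; move: ct => /andP[h1 h2].
    have b'0 := lt_trans h1 h2.
    rewrite /= -crE ltr_pdivrMr// h1 divr_gt0//= ltr_pdivlMr; last lra.
    move=> h3; have := det t; nra.
  have {sub} : (mu (cset c `&` [set t | (0 < alpha n (frac_part t) < s)%R])
      <= mu [set` i])%E.
    apply: le_measure; rewrite ?inE//.
    apply: measurableI; first exact: measurable_cset H.
    exact: measurable_alpha_lt.
  rewrite mui => /le_trans; apply.
  rewrite (lebesgue_measure_cset _ _ H) -EFinM lee_fin /clen.
  rewrite ler_pdivlMr; last nra.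
  rewrite [leLHS](_ : _ = s * (1 + cden_prev c / cden c)); last first.
    by field; rewrite gt_eqF//; lra.
  have : cden_prev c / cden c <= 1 by rewrite ler_pdivrMr; lra.
  nra.
- have Hc a : is_cell n.+1 (child c a.+1) by exact: childP.
  pose F a := cset (child c a.+1) `&` [set t | 0 < alpha (n.+1 + m) (frac_part t) < s].
  have mF a : measurable (F a).
    by apply: measurableI; [exact: measurable_cset (Hc a)|exact: measurable_alpha_lt].
  have sub : cset c `&` [set t | 0 < alpha (n + m.+1) (frac_part t) < s]
     `<=` \bigcup_a F a.
    move=> t [ct]; rewrite -addSnnS => /= /[dup] h3 /andP[h1 h2].
    have [h4 h5] := cset_childP _ _ _ H ct (alpha_neq0_of_later_gt0 _ _ _ h1).
    (* Partial quotients are at least [1], whence the shift of the index. *)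
    by exists (Num.truncn (alpha n (frac_part t))^-1).-1 => //; rewrite /F prednK.
  apply: le_trans (measure_sigma_subadditive mu mF _ sub) _.
    apply: measurableI; first exact: measurable_cset H.
    exact: measurable_alpha_lt.
  apply: (@le_trans _ _ (\sum_(0 <= a <oo) (2 * s)%:E * mu (cset (child c a.+1)))%E).
    by apply: lee_nneseries => // a _; exact: IH.
  rewrite nneseriesZl// lee_wpmul2l ?lee_fin ?mulr_ge0//.
  apply: (@le_trans _ _ (mu (\bigcup_a cset (child c a.+1)))).
    rewrite measure_bigcup//=.
    + by under [X in (_ <= X)%E]eq_eseriesl do rewrite in_setT.
    + by move=> a _; exact: measurable_cset (Hc a).
    + move=> a b _ _ [t [h1 h2]]; apply: succn_inj.
      exact: cset_child_disjoint h1 h2.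
  apply: le_measure; rewrite ?inE.
  + by apply: bigcup_measurable => a _; exact: measurable_cset (Hc a).
  + exact: measurable_cset H.
  + by move=> t [a _]; exact: cset_child_sub.
Qed.

End cell_measure.

(** * Integrals of the terms over subsets of a cell *)

Section log_integral.
Context {R : realType}.
Local Notation mu := (@lebesgue_measure R).
Implicit Types (c : cell R) (I : set R) (u r lam t : R).

Lemma nneseries_geometric (a z : R) : `|z| < 1 ->
  (\sum_(0 <= k <oo) (a * z ^+ k)%:E = (a / (1 - z))%:E)%E.
Proof.
move=> z1; apply/cvg_lim => //.
rewrite (_ : (fun n => _) = EFin \o series (geometric a z)); last first.
  by apply/funext => n; rewrite /series/= -sumEFin.
by apply: cvg_EFin; [exact: nearW|exact: cvg_geometric_series].
Qed.

(** Each doubling of [r] adds [ln 2 <= 1] to the logarithm and one to the count. *)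
Lemma ln_le_count_dyadic (N : nat) r : 0 < r -> r <= 2 ^+ N ->
  ln r <= \sum_(0 <= j < N) (2 ^+ j < r)%R%:R.
Proof.
move=> r0; elim: N => [|N IH] rN.
  by rewrite big_nil ln_le0.
rewrite big_nat_recr//=; have [h|h] := leP r (2 ^+ N).
  by rewrite addr0 IH.
have -> : \sum_(0 <= j < N) (2 ^+ j < r)%R%:R = N%:R :> R.
  rewrite big_nat (eq_bigr (fun=> 1)) => [|j /andP[_ jN]].
    by rewrite -big_nat sumr_const_nat subn0.
  by rewrite (le_lt_trans _ h)// ler_eXn2l ?ltr1n// ltnW.
rewrite natr1; apply: (le_trans (_ : _ <= ln (2 ^+ N.+1))).
  by rewrite ler_ln// posrE exprn_gt0.
rewrite lnXn// -(mulr_natl (ln 2)) -[leRHS]mulr1 ler_wpM2l//.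
by rewrite -ler_expR lnK ?posrE//; exact: expR_ge1Dx.
Qed.

Definition alpha_band lam (j : nat) : set R :=
  [set v | 0 < v < expR (- lam) * 2^-1 ^+ j].

(** This bounds an integral of the logarithm by measures of sets [alpha < s], with the
    threshold [exp (- lam)] free to be matched with the size of the domain. *)
Lemma ln_invr_le_bands lam u : 0 <= lam -> 0 <= u ->
  ((ln u^-1)%:E <= lam%:E + \sum_(0 <= j <oo) (\1_(alpha_band lam j) u)%:E)%E.
Proof.
move=> lam0.
rewrite le_eqVlt => /predU1P[<-|u0].
  by rewrite invr0 ln0// adde_ge0// nneseries_ge0.
pose r := u^-1 * expR (- lam).
have r0 : 0 < r by rewrite mulr_gt0 ?invr_gt0 ?expR_gt0.
have -> : ln u^-1 = lam + ln r.
  by rewrite /r lnM ?posrE ?invr_gt0 ?expR_gt0// expRK addrCA subrr addr0.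
rewrite EFinD leeD2l//.
pose N := Num.truncn r.
have rN : r <= 2 ^+ N.
  have := truncnS_gt r; move/ltW/le_trans; apply.
  by rewrite -natrX ler_nat -/N ltn_expl.
apply: le_trans (nneseries_lim_ge N _); last by [].
rewrite sumEFin lee_fin; apply: (le_trans (ln_le_count_dyadic N _ r0 rN)).
apply: ler_sum => j _; rewrite indicE ler_nat.
case: ltP => //= h; rewrite mem_set// /alpha_band/= u0/=.
move: h; rewrite /r mulrC ltr_pdivlMr// => h.
by rewrite exprVn ltr_pdivlMr ?exprn_gt0// mulrC.
Qed.

(** Up to [lam] the logarithm is bounded by a constant on [I]; its excess over [lam] is
    controlled on the whole cell, whatever [I] is. *)
Lemma integral_ln_alpha n m c I lam : is_cell n c -> measurable I ->
  I `<=` cset c -> 0 <= lam ->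
  (\int[mu]_(t in I) (ln (alpha (n + m) (frac_part t))^-1)%:E <=
   lam%:E * mu I + (4 * expR (- lam) * clen c)%:E)%E.
Proof.
move=> H mI Ic lam0.
pose B j := [set t : R | 0 < alpha (n + m) (frac_part t) <
                         expR (- lam) * 2^-1 ^+ j].
have mB j : measurable (B j) by exact: measurable_alpha_lt.
have mf j : measurable_fun I (fun t => (\1_(B j) t)%:E : \bar R).
  by apply/measurable_EFinP; exact: measurable_indic.
have msum : measurable_fun I
    (fun t => \sum_(0 <= j <oo) (\1_(B j) t)%:E : \bar R)%E.
  apply: (@ge0_emeasurable_sum _ _ _ I _ xpredT) => [k t _ _|k _].
    by rewrite lee_fin.
  exact: mf.
apply: (@le_trans _ _ (\int[mu]_(t in I)
    (lam%:E + \sum_(0 <= j <oo) (\1_(B j) t)%:E))%E).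
  apply: ge0_le_integral => //.
  - by move=> t _; rewrite lee_fin ln_invr_alpha_ge0.
  - apply/measurable_EFinP; apply: measurable_funTS.
    exact: measurable_ln_invr_alpha.
  - exact: emeasurable_funD.
  - move=> t _; have /andP[a0 _] := alpha_itv (n + m) t.
    exact: ln_invr_le_bands lam _ lam0 a0.
rewrite ge0_integralD//; last by move=> t _; apply: nneseries_ge0.
rewrite integral_cst// leeD2l//.
rewrite integral_nneseries//.
apply: (@le_trans _ _ (\sum_(0 <= j <oo)
   ((2 * expR (- lam) * clen c) * 2^-1 ^+ j)%:E)%E).
  apply: lee_nneseries => [j _ _|j _]; first by apply: integral_ge0 => t _.
  rewrite integral_indic//; last exact: mB.
  apply: (@le_trans _ _ (mu (cset c `&` B j))).
    apply: le_measure; rewrite ?inE.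
    - by apply: measurableI; [exact: mB|].
    - by apply: measurableI; [exact: measurable_cset H|exact: mB].
    - by move=> t [Bt /Ic ct].
  apply: (le_trans (alpha_lt_measure m n c _ H _)).
    by rewrite mulr_ge0 ?expR_ge0// exprn_ge0.
  rewrite (lebesgue_measure_cset _ _ H) -EFinM lee_fin.
  by rewrite le_eqVlt; apply/orP; left; apply/eqP; ring.
rewrite nneseries_geometric; last by rewrite ger0_norm//; lra.
by rewrite lee_fin le_eqVlt; apply/orP; left; apply/eqP; field.
Qed.

Lemma integral_wgamma n k c I lam M : is_cell n c -> measurable I ->
  I `<=` cset c -> 0 <= lam ->
  (forall t, I t -> beta_pred (n + k) (frac_part t) <= M) -> 0 <= M ->
  (\int[mu]_(t in I) (wgamma (n + k) (frac_part t))%:E <=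
   M%:E * (lam%:E * mu I + (4 * expR (- lam) * clen c)%:E))%E.
Proof.
move=> H mI Ic lam0 bM M0.
apply: (@le_trans _ _ (\int[mu]_(t in I)
    (M%:E * (ln (alpha (n + k) (frac_part t))^-1)%:E))%E).
  apply: ge0_le_integral => //.
  - by move=> t _; rewrite lee_fin wgamma_ge0.
  - by apply/measurable_EFinP; apply: measurable_funTS; exact: measurable_wgamma.
  - apply: emeasurable_funM => //; apply/measurable_EFinP.
    apply: measurable_funTS; exact: measurable_ln_invr_alpha.
  - move=> t It; rewrite -EFinM lee_fin ler_wpM2r ?ln_invr_alpha_ge0//.
    exact: bM.
rewrite ge0_integralZl//; last 2 first.
- apply/measurable_EFinP; apply: measurable_funTS.
  exact: measurable_ln_invr_alpha.
- by move=> t _; rewrite lee_fin ln_invr_alpha_ge0.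
by rewrite lee_wpmul2l ?lee_fin//; exact: integral_ln_alpha.
Qed.

(** The bound for one term decreases by the factor [3/4] with the index, and
    [2 * sum (3/4)^k = 8]. *)
Lemma integral_wgamma_tail n i c I lam M : is_cell n c -> measurable I ->
  I `<=` cset c -> 0 <= lam ->
  (forall t, I t -> beta_pred (n + i) (frac_part t) <= M) -> 0 <= M ->
  (\int[mu]_(t in I) (\sum_(0 <= k <oo) (wgamma (n + i + k) (frac_part t))%:E) <=
   (8 * M)%:E * (lam%:E * mu I + (4 * expR (- lam) * clen c)%:E))%E.
Proof.
move=> H mI Ic lam0 bM M0.
rewrite integral_nneseries//; last 2 first.
- move=> k; apply/measurable_EFinP; apply: measurable_funTS.
  exact: measurable_wgamma.
- by move=> k t _; rewrite lee_fin wgamma_ge0.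
set K := (X in (_ * X)%E).
have K0 : (0 <= K)%E.
  rewrite adde_ge0// ?mule_ge0// lee_fin mulr_ge0 ?mulr_ge0 ?expR_ge0//.
  by rewrite ltW// (clen_gt0 _ _ H).
have Kfin : K \is a fin_num.
  rewrite fin_numD fin_numM//= ge0_fin_numE//.
  apply: (@le_lt_trans _ _ (mu (cset c))); last first.
    by rewrite (lebesgue_measure_cset _ _ H) ltry.
  by apply: le_measure; rewrite ?inE//; exact: measurable_cset H.
apply: (@le_trans _ _ (\sum_(0 <= k <oo) (fine K)%:E * ((2 * M) * (3/4) ^+ k)%:E)%E).
  apply: lee_nneseries => [k _ _|k _].
    by apply: integral_ge0 => t _; rewrite lee_fin wgamma_ge0.
  rewrite fineK// muleC -addnA; apply: integral_wgamma => // [t It|].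
    rewrite addnA (le_trans (beta_pred_geometric _ _ _))//.
    rewrite [leLHS]mulrCA -[leRHS]mulrA ler_wpM2l//.
    by rewrite ler_wpM2r ?exprn_ge0// bM.
  by rewrite !mulr_ge0 ?exprn_ge0.
rewrite nneseriesZl; last first.
  by move=> k _; rewrite lee_fin !mulr_ge0 ?exprn_ge0//.
rewrite fineK// muleC lee_wpmul2r// nneseries_geometric; last by rewrite ger0_norm; lra.
by rewrite lee_fin le_eqVlt; apply/orP; left; apply/eqP; field.
Qed.

End log_integral.

(** * Estimates for logarithms *)

Section log_estimates.
Context {R : realType}.
Implicit Types (u v w x y z q Q D h m : R).

Lemma ln_le_subr1 x : 0 < x -> ln x <= x - 1.
Proof. by move=> x0; have := expR_ge1Dx (ln x); rewrite lnK// => ?; lra. Qed.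

Lemma ler_dist_ln m y z : 0 < m -> m <= y -> m <= z ->
  `|ln y - ln z| <= `|y - z| / m.
Proof.
move=> m0; wlog yz : y z / z <= y => [H|] my mz.
  by have [/H|/ltW/H] := leP z y; [exact|rewrite distrC (distrC y); exact].
have z0 : 0 < z by lra.
rewrite !ger0_norm ?subr_ge0// ?ler_ln ?posrE//; last lra.
rewrite -ln_div ?posrE//; last lra.
apply: (le_trans (ln_le_subr1 _ _)); first by rewrite divr_gt0//; lra.
rewrite ler_pdivlMr//.
rewrite (_ : y / z - 1 = (y - z) / z); last by field; rewrite gt_eqF.
rewrite mulrAC ler_pdivrMr// ler_wpM2l// subr_ge0//.
Qed.

Lemma mulr_ln_invr_le q v : 0 < q -> 0 < v -> v * ln (q * v)^-1 <= q^-1.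
Proof.
move=> q0 v0; have qv : 0 < q * v by rewrite mulr_gt0.
have := ln_le_subr1 (q * v)^-1; rewrite invr_gt0 => /(_ qv).
move/(ler_wpM2l (ltW v0))/le_trans; apply.
rewrite mulrBr mulr1 invfM mulrCA divff ?gt_eqF// mulr1; lra.
Qed.

Lemma ln2_le1 : ln 2 <= 1 :> R.
Proof. by apply: (le_trans (ln_le_subr1 _ _)); lra. Qed.

(** Here [v], [w] and [z] stand for the values of [beta_n], [beta_(n+1)] and [beta_(n+2)]
    at [x], [q] and [Q] for [q_n] and [q_(n+1)], and [D] for the length of the cell of
    depth [n].  Two cases bound [h] from below according to the endpoint of the
    next cell that is reached.  At the endpoint with [alpha_(n+1) = 0] the loss is
    [ln (v / w)].  At the endpoint with [alpha_(n+1) = 1] it is [ln (v / (v - w))], which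
    is large only if [2 w > v]; then the next partial quotient is [1], so that
    [z = v - w] and the loss is essentially [ln (w / z)]. *)
Lemma escape_bound q Q v w z D h :
  0 < q -> 0 < Q -> 0 < D -> 0 < h -> 0 < w < v -> 0 < z < w ->
  q * v <= 1 -> Q * v <= 1 -> D * q ^+ 2 <= 1 ->
  w <= Q * h \/ (v - w <= 2 * Q * h /\ (w <= v / 2 \/ z = v - w)) ->
  v * ln (D / h) <= 4 / q + v * ln (v / w) + 2 * (w * ln (w / z)).
Proof.
move=> q0 Q0 D0 h0 /andP[w0 wv] /andP[z0 zw] qv Qv Dq H.
have v0 : 0 < v by lra.
have vq : v <= q^-1 by rewrite -[leRHS]mul1r ler_pdivlMr// mulrC.
have lvw : 0 <= v * ln (v / w).
  by rewrite mulr_ge0 ?ln_ge0 ?ler_pdivlMr// ?mul1r; lra.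
have lwz : 0 <= w * ln (w / z).
  by rewrite mulr_ge0 ?ln_ge0 ?ler_pdivlMr// ?mul1r; lra.
(* Both cases bound [h] from below: [y] is [w] or [v - w], and [K] is [1] or [2]. *)
have key K y : 0 < y -> 0 < K -> y <= K * Q * h ->
    v * ln (D / h) <= 2 / q + v * ln K + v * ln (v / y).
  move=> y0 K0 yh.
  have DE : D / h <= ((q * v)^-1) ^+ 2 * (K * (v / y)).
    rewrite ler_pdivrMr//.
    have -> : (q * v)^-1 ^+ 2 * (K * (v / y)) * h = (K * h) / (q ^+ 2 * v * y).
      by field; rewrite !gt_eqF.
    rewrite ler_pdivlMr ?mulr_gt0 ?exprn_gt0//.
    have -> : D * (q ^+ 2 * v * y) = (D * q ^+ 2) * (v * y) by ring.
    have h1 : v * y <= K * h.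
      apply: (@le_trans _ _ (v * (K * Q * h))); first by rewrite ler_wpM2l// ltW.
      rewrite (_ : v * _ = (Q * v) * (K * h)); last by ring.
      by rewrite ler_piMl// mulr_ge0// ltW.
    apply: le_trans h1; rewrite ler_piMl// mulr_ge0// ltW//.
  have P1 : 0 < (q * v)^-1 by rewrite invr_gt0 mulr_gt0.
  have P2 : 0 < v / y by rewrite divr_gt0.
  have P3 : 0 < (q * v)^-1 ^+ 2 * (K * (v / y)).
    by apply: mulr_gt0; [exact: exprn_gt0|exact: mulr_gt0].
  have P4 : 0 < D / h by rewrite divr_gt0.
  have : ln (D / h) <= 2 * ln (q * v)^-1 + (ln K + ln (v / y)).
    apply: (@le_trans _ _ (ln ((q * v)^-1 ^+ 2 * (K * (v / y))))).
      by rewrite ler_ln.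
    have P5 : 0 < (q * v)^-1 ^+ 2 by exact: exprn_gt0.
    have P6 : 0 < K * (v / y) by exact: mulr_gt0.
    rewrite (lnM P5 P6) (lnM K0 P2) lnXn//.
    by rewrite -(mulr_natl (ln (q * v)^-1) 2%N).
  move/(ler_wpM2l (ltW v0)) => /le_trans; apply.
  have := mulr_ln_invr_le _ _ q0 v0; lra.
have [h1|[h1 h2]] := H.
  have := key 1 w w0 ltr01; rewrite mul1r ln1 mulr0 => /(_ h1).
  have : 0 < q^-1 by rewrite invr_gt0. lra.
have vl2 : v * ln 2 <= q^-1.
  by apply: le_trans vq; rewrite -[leRHS]mulr1 ler_wpM2l ?(ltW v0)// ln2_le1.
have vw0 : 0 < v - w by lra.
have := key 2 (v - w) vw0 (ltr0Sn _ _) h1.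
case: h2 => [h2|zE].
  have : v * ln (v / (v - w)) <= v * ln 2.
    rewrite ler_wpM2l ?(ltW v0)// ler_ln ?posrE ?divr_gt0//.
    by rewrite ler_pdivrMr//; lra.
  lra.
have [h2|h2] := leP w (v / 2).
  have : v * ln (v / (v - w)) <= v * ln 2.
    rewrite ler_wpM2l ?(ltW v0)// ler_ln ?posrE ?divr_gt0//.
    by rewrite ler_pdivrMr//; lra.
  lra.
rewrite -zE; have -> : v / z = (v / w) * (w / z).
  by field; rewrite !gt_eqF.
have -> : ln (v / w * (w / z)) = ln (v / w) + ln (w / z).
  by rewrite lnM ?posrE ?divr_gt0.
rewrite mulrDr.
have : v * ln (v / w) <= v * ln 2.
  rewrite ler_wpM2l ?(ltW v0)// ler_ln ?posrE ?divr_gt0//.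
  by rewrite ler_pdivrMr//; lra.
have : v * ln (w / z) <= 2 * (w * ln (w / z)).
  rewrite mulrA ler_wpM2r ?ln_ge0 ?ler_pdivlMr ?mul1r//; lra.
lra.
Qed.

End log_estimates.

(** * Size and variation of the terms on a cell *)

Section cell_estimates.
Context {R : realType}.
Implicit Types (c : cell R) (n a k : nat) (s t : R).

Lemma crem_dist n c s t : is_cell n c ->
  `|crem c t - crem c s| = cden c * `|t - s|.
Proof.
move=> H; have [e [p [e2 crE]]] := crem_affine _ _ H.
rewrite !crE (_ : _ - _ = e * (cden c * (t - s))); last by ring.
have e1 : `|e| = 1.
  by move/eqP: e2; rewrite sqrf_eq1 => /orP[] /eqP ->; rewrite ?normrN normr1.
by rewrite !normrM e1 mul1r (gtr0_norm (cden_gt0 _ _ H)).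
Qed.

Lemma crem_prev_dist n c s t : is_cell n c ->
  `|crem_prev c t - crem_prev c s| = cden_prev c * `|t - s|.
Proof.
move=> H; have q0 := cden_gt0 _ _ H.
apply: (mulfI (lt0r_neq0 q0)); rewrite -{1}(gtr0_norm q0) -normrM.
have -> : cden c * (crem_prev c t - crem_prev c s) =
    cden_prev c * (crem c s - crem c t).
  by have := crem_det _ _ H t; have := crem_det _ _ H s; lra.
rewrite normrM ger0_norm ?(cden_prev_ge0 _ _ H)// distrC (crem_dist _ _ _ _ H).
by rewrite mulrCA.
Qed.

Lemma crem_prev_le n c t : is_cell n c -> cset c t ->
  crem_prev c t <= (cden c)^-1.
Proof.
move=> H /andP[h1 h2]; rewrite -[leRHS]mul1r ler_pdivlMr ?(cden_gt0 _ _ H)//.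
have := crem_det _ _ H t; have := cden_prev_ge0 _ _ H.
nra.
Qed.

Lemma crem_prev_ge n c t : is_cell n c -> cset c t ->
  (2 * cden c)^-1 <= crem_prev c t.
Proof.
move=> H /andP[h1 h2]; rewrite -[leLHS]mul1r ler_pdivrMr; last first.
  by rewrite mulr_gt0// (cden_gt0 _ _ H).
have := crem_det _ _ H t; have := cden_prev_ge0 _ _ H.
have := cden_prev_le _ _ H; nra.
Qed.

Lemma clen_le n c : is_cell n c -> clen c * cden c ^+ 2 <= 1.
Proof.
move=> H; rewrite /clen mulrC ler_pdivrMr ?mul1r.
  by have := cden_prev_ge0 _ _ H; have := cden_gt0 _ _ H; nra.
by have := cden_prev_ge0 _ _ H; have := cden_gt0 _ _ H; nra.
Qed.

Lemma wgamma_cell n c t : is_cell n c -> cset c t ->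
  wgamma n (frac_part t) = crem_prev c t * ln (crem_prev c t / crem c t).
Proof.
move=> H ct.
by rewrite /wgamma (alpha_cell _ _ H)// (beta_pred_cell _ _ H)// invf_div.
Qed.

(** The term is [u (ln u - ln v)] with [u] and [v] affine, and on the child cell both are
    bounded below, [u] by [1 / (2 q_n)] and [v] by [1 / (2 q_(n+1))]. *)
Lemma wgamma_lipschitz n c a s t : is_cell n c -> (0 < a)%N ->
  cset (child c a) s -> cset (child c a) t ->
  `|wgamma n (frac_part t) - wgamma n (frac_part s)| <=
  6 * cden (child c a) * `|t - s|.
Proof.
move=> H a0 ds dt; have H' := childP _ _ _ a0 H.
have cs := cset_child_sub _ _ a0 _ ds; have ct := cset_child_sub _ _ a0 _ dt.
rewrite !(wgamma_cell _ _ _ H)//.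
have q0 := cden_gt0 _ _ H; have Q0 := cden_gt0 _ _ H'.
have qQ : cden c <= cden (child c a).
  by have := cden_prev_le _ _ H'.
have q'q := cden_prev_le _ _ H; have q'0 := cden_prev_ge0 _ _ H.
have ut := crem_prev_le _ _ _ H ct; have us := crem_prev_le _ _ _ H cs.
have ut' := crem_prev_ge _ _ _ H ct; have us' := crem_prev_ge _ _ _ H cs.
have vt' := crem_prev_ge _ _ _ H' dt; have vs' := crem_prev_ge _ _ _ H' ds.
rewrite /= -/(cden (child c a)) in vt' vs'.
have du := crem_prev_dist _ _ s t H; have dv := crem_dist _ _ s t H.
move: cs ct => /andP[v0s uvs] /andP[v0t uvt].
move: us' vs' us ut' vt' ut du dv v0s uvs v0t uvt.
set us := crem_prev c s; set vs := crem c s.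
set ut := crem_prev c t; set vt := crem c t.
set q := cden c in q0 qQ q'q *; set q' := cden_prev c in q'q q'0 *.
set Q := cden _ in Q0 qQ * => us' vs' us_ ut' vt' ut_ du dv v0s uvs v0t uvt.
have us0 : 0 < us by lra.
have ut0 : 0 < ut by lra.
rewrite !ln_div ?posrE//.
have -> : ut * (ln ut - ln vt) - us * (ln us - ln vs) =
  (ut - us) * (ln us - ln vs) + ut * ((ln ut - ln us) - (ln vt - ln vs)).
  by ring.
apply: (le_trans (ler_normD _ _)); rewrite !normrM.
have T0 := normr_ge0 (t - s).
have A : `|ln us - ln vs| <= 2 * Q / q.
  rewrite -ln_div ?posrE// ger0_norm; last first.
    by rewrite ln_ge0// ler_pdivlMr// mul1r ltW.
  have r0 : 0 < us / vs by rewrite divr_gt0.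
  apply: (le_trans (ln_le_subr1 _ r0)).
  apply: (@le_trans _ _ (us / vs)); first lra.
  have vs'' : vs^-1 <= 2 * Q by rewrite invf_ple ?posrE ?mulr_gt0.
  by rewrite (mulrC _ q^-1) ler_pM// ?invr_ge0 ltW.
have B : `|ln ut - ln us| <= 2 * q * (q' * `|t - s|).
  rewrite -du mulrC -(invrK (2 * q)); apply: ler_dist_ln => //.
  by rewrite invr_gt0 mulr_gt0.
have C : `|ln vt - ln vs| <= 2 * Q * (q * `|t - s|).
  rewrite -dv mulrC -(invrK (2 * Q)); apply: ler_dist_ln => //.
  by rewrite invr_gt0 mulr_gt0.
have D : `|ut - us| * `|ln us - ln vs| <= 2 * Q * `|t - s|.
  rewrite du; apply: (@le_trans _ _ ((q * `|t - s|) * (2 * Q / q))).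
    by apply: ler_pM => //; [rewrite mulr_ge0|rewrite ler_wpM2r].
  by rewrite le_eqVlt; apply/orP; left; apply/eqP; field; rewrite gt_eqF.
have E : `|ut| * `|ln ut - ln us - (ln vt - ln vs)| <= 4 * Q * `|t - s|.
  rewrite gtr0_norm//.
  apply: (@le_trans _ _ (q^-1 * (2 * Q * (q * `|t - s|) + 2 * Q * (q * `|t - s|)))).
    apply: ler_pM => //; first exact: ltW.
    apply: (le_trans (ler_normB _ _)); apply: lerD => //.
    apply: (le_trans B).
    rewrite [leRHS](_ : _ = 2 * (q * (Q * `|t - s|))); last by ring.
    rewrite [leLHS](_ : _ = 2 * (q * (q' * `|t - s|))); last by ring.
    by rewrite ler_wpM2l// ler_wpM2l ?(ltW q0)// ler_wpM2r//; lra.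
  by rewrite le_eqVlt; apply/orP; left; apply/eqP; field; rewrite gt_eqF.
lra.
Qed.

End cell_estimates.

(** * The cells around an irrational number *)

Section irrational_expansion.
Context {R : realType}.
Implicit Types (x t : R) (n k : nat).

Lemma irrational_neq0 x : irrational x -> x != 0.
Proof. by apply: contra_notN => /eqP ->; exists 0 => //; rewrite rmorph0. Qed.

Lemma irrational_invr x : irrational x -> irrational x^-1.
Proof.
by apply: contra_not => -[q _ qx]; exists q^-1 => //; rewrite fmorphV/= qx invrK.
Qed.

Lemma irrational_frac_part x : irrational x -> irrational (frac_part x).
Proof.
apply: contra_not => -[q _ qx]; exists (q + (Num.floor x)%:~R) => //.
by rewrite rmorphD/= ratr_int qx subrK.
Qed.

Lemma irrational_alpha k x : irrational x -> irrational (alpha k (frac_part x)).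
Proof.
move=> ix; elim: k => [|k IH]; first exact: irrational_frac_part.
by rewrite alphaS; exact/irrational_frac_part/irrational_invr.
Qed.

Lemma alpha_neq0 k x : irrational x -> alpha k (frac_part x) != 0.
Proof. by move=> ix; exact/irrational_neq0/irrational_alpha. Qed.

Definition partial_quotient x n : nat :=
  Num.truncn (alpha n (frac_part x))^-1.

Fixpoint cell_at x n : cell R :=
  if n is m.+1 then child (cell_at x m) (partial_quotient x m)
  else root_cell (Num.floor x).

Lemma cell_atP x n : irrational x ->
  [/\ is_cell n (cell_at x n), cset (cell_at x n) x &
      (0 < partial_quotient x n)%N].
Proof.
move=> ix; elim: n => [|n [IH1 IH2 IH3]].
  have H := @root_cellP R (Num.floor x).
  have /andP[a0 a1] := frac_part_itv x.
  have cx : cset (root_cell (Num.floor x)) x.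
    rewrite /cset/=; apply/andP; split; last exact: a1.
    by rewrite lt_neqAle eq_sym (alpha_neq0 0).
  by split => //; have [] := cset_childP _ _ _ H cx (alpha_neq0 1 _ ix).
have [h1 h2] := cset_childP _ _ _ IH1 IH2 (alpha_neq0 n.+1 _ ix).
have H := childP _ _ _ IH3 IH1.
by split => //; have [] := cset_childP _ _ _ H h2 (alpha_neq0 n.+2 _ ix).
Qed.

Lemma cell_at_sub x n k : irrational x ->
  cset (cell_at x (n + k)) `<=` cset (cell_at x n).
Proof.
move=> ix; elim: k => [|k IH]; first by rewrite addn0.
rewrite addnS /=; have [_ _ p0] := cell_atP x (n + k) ix.
exact: subset_trans (cset_child_sub _ _ p0) IH.
Qed.

(** This form, rather than a multiple of [q_n], is stable under the recurrence
    [q_(n+1) >= q_n + q_(n-1)]. *)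
Lemma sum_cden_le x n : irrational x ->
  \sum_(0 <= k < n.+1) cden (cell_at x k) <=
  2 * cden (cell_at x n) + cden_prev (cell_at x n).
Proof.
move=> ix; elim: n => [|n IH]; first by rewrite big_nat1/=; lra.
rewrite big_nat_recr//=.
have [H _ p0] := cell_atP x n ix.
have a1 : 1 <= (partial_quotient x n)%:R :> R by rewrite ler1n.
have q1 := cden_ge1 _ _ H.
move: IH a1; set S := \sum_(_ <= _ < _) _; set p := _%:R.
nra.
Qed.

Lemma sum_cden_le3 x n : irrational x ->
  \sum_(0 <= k < n.+1) cden (cell_at x k) <= 3 * cden (cell_at x n).
Proof.
move=> ix; have := sum_cden_le x n ix; have [H _ _] := cell_atP x n ix.
have := cden_prev_le _ _ H; lra.
Qed.

Lemma cden_at_ge x n : irrational x -> n.+1%:R <= 3 * cden (cell_at x n).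
Proof.
move=> ix; apply: le_trans (sum_cden_le3 x n ix).
rewrite (_ : n.+1%:R = \sum_(0 <= k < n.+1) 1); last first.
  by rewrite sumr_const_nat subn0.
apply: ler_sum => k _; have [H _ _] := cell_atP x k ix; exact: cden_ge1 H.
Qed.

Lemma inv_cden_cvg0 x : irrational x ->
  (cden (cell_at x n))^-1 @[n --> \oo] --> (0 : R).
Proof.
move=> ix; apply: (@squeeze_cvgr _ _ _ _ (fun=> 0) (fun n => 3 * n.+1%:R^-1)).
- apply: nearW => n; have [H _ _] := cell_atP x n ix.
  have q0 := cden_gt0 _ _ H; rewrite invr_ge0 ltW//=.
  rewrite -[leLHS]mul1r ler_pdivrMr// mulrAC ler_pdivlMr// mul1r.
  exact: cden_at_ge.
- exact: cvg_cst.
- rewrite -[X in _ --> X](mulr0 3); apply: cvgMl_tmp.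
  exact: cvg_harmonic.
Qed.

Lemma sum_wgamma_dist x n t : irrational x -> cset (cell_at x n) t ->
  \sum_(0 <= k < n) `|wgamma k (frac_part t) - wgamma k (frac_part x)| <=
  18 * cden (cell_at x n) * `|t - x|.
Proof.
move=> ix ct.
apply: (@le_trans _ _ (\sum_(0 <= k < n) 6 * cden (cell_at x k.+1) * `|t - x|)).
  rewrite !big_nat; apply: ler_sum => k /andP[_ kn].
  have [H cx p0] := cell_atP x k ix; have [_ cx1 _] := cell_atP x k.+1 ix.
  apply: wgamma_lipschitz => //.
  by apply: (cell_at_sub x k.+1 (n - k.+1)) => //; rewrite subnKC.
rewrite -mulr_suml ler_wpM2r// -mulr_sumr.
have := sum_cden_le3 x n ix; rewrite big_nat_recl//=; lra.
Qed.

(** The point [t] outside the child may be any point of the interval under study, so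
    that the length of the interval can replace [|t - x|]. *)
Lemma escape_wgamma n (c : cell R) a a' x t : is_cell n c ->
  (0 < a)%N -> (0 < a')%N -> cset (child (child c a) a') x ->
  ~ cset (child c a) t ->
  0 < `|t - x| /\
  crem c x * ln (clen c / `|t - x|) <=
  4 / cden c + wgamma n.+1 (frac_part x) + 2 * wgamma n.+2 (frac_part x).
Proof.
move=> H a0 a'0 ex ndt.
have H1 := childP _ _ _ a0 H; have H2 := childP _ _ _ a'0 H1.
have dx := cset_child_sub _ _ a'0 _ ex; have cx := cset_child_sub _ _ a0 _ dx.
have tx : 0 < `|t - x|.
  by rewrite normr_gt0 subr_eq0; apply/eqP => E; apply: ndt; rewrite E.
split => //; rewrite (wgamma_cell _ _ _ H1 dx) (wgamma_cell _ _ _ H2 ex).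
have D0 := clen_gt0 _ _ H; have q0 := cden_gt0 _ _ H.
have Q0 := cden_gt0 _ _ H1; have Q'E := crem_det _ _ H1 x.
have qE := crem_det _ _ H x; have q'0 := cden_prev_ge0 _ _ H.
have Dq := clen_le _ _ H; have Qq := cden_prev_le _ _ H1.
have bd := crem_dist _ _ x t H1; have bd' := crem_prev_dist _ _ x t H1.
have ndt' : crem (child c a) t <= 0 \/ crem_prev (child c a) t <= crem (child c a) t.
  apply/orP; rewrite !leNgt -negb_and; apply/negP => /andP[h1 h2].
  by apply: ndt; rewrite /cset/= h1 h2.
have vE : crem_prev (child c a) =1 crem c by [].
have wE : crem_prev (child (child c a) a') =1 crem (child c a) by [].
have zE : crem (child (child c a) a') x =
  crem c x - a'%:R * crem (child c a) x by [].
have q'E : cden_prev (child c a) = cden c by [].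
move: cx dx ex => /andP[_ vu] /andP[w0 wv] /andP[z0 zw].
rewrite zE wE vE q'E in Q'E Qq bd bd' vu w0 wv z0 zw ndt' *.
rewrite !vE in bd' ndt'.
move: (child c a) H1 H2 Q0 Q'E Qq bd ndt' w0 wv z0 zw {ndt vE wE zE q'E} => d.
move=> H1 H2 Q0 Q'E Qq bd ndt' w0 wv z0 zw.
apply: (escape_bound _ (cden d)) => //.
- by rewrite w0 wv.
- by rewrite z0 zw.
- nra.
- nra.
have [h|h] := ndt'.
  by left; rewrite -bd distrC ler_normr; apply/orP; left; lra.
right; split.
  have : `|crem c t - crem c x| + `|crem d t - crem d x| <= 2 * cden d * `|t - x|.
    by rewrite bd bd'; nra.
  have := ler_norm (crem d t - crem d x).
  have := ler_norm (crem c x - crem c t); rewrite distrC.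
  lra.
(* If [a' >= 2] then [0 < z = v - a' w] forces [w < v / 2]. *)
case: a' a'0 z0 {H2 zw} => [//|[|k]] _ z0; first by right; rewrite mul1r.
left; have : 2 <= k.+2%:R :> R by rewrite ler_nat.
nra.
Qed.

End irrational_expansion.

(** * Almost everywhere convergence and local integrability *)

Section wilton_integrability.
Context {R : realType}.
Local Notation mu := (@lebesgue_measure R).
Implicit Types (t : R) (n k : nat).

(** The tail of the series of absolute values, as an extended real since it may
    diverge. *)
Definition wtail n t : \bar R :=
  (\sum_(0 <= k <oo) (wgamma (n + k)%N (frac_part t))%:E)%E.

Lemma wtail_ge0 n t : (0 <= wtail n t)%E.
Proof. by apply: nneseries_ge0 => k _ _; rewrite lee_fin wgamma_ge0. Qed.

Lemma measurable_wtail n : measurable_fun setT (wtail n).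
Proof.
apply: (@ge0_emeasurable_sum _ _ _ setT _ xpredT) => [k t _ _|k _].
  by rewrite lee_fin wgamma_ge0.
by apply/measurable_EFinP; exact: measurable_wgamma.
Qed.

Lemma wilton_number_wtail t : irrational t -> (wtail 0 t < +oo)%E ->
  wilton_number t.
Proof.
move=> it h; split => //; apply: normed_cvg.
rewrite (_ : [normed _] = series (fun k => wgamma k (frac_part t))).
  by apply: nnseries_is_cvg => // k; exact: wgamma_ge0.
congr series; apply/funext => k /=.
by rewrite normrM normrX normrN1 expr1n mul1r ger0_norm// wgamma_ge0.
Qed.

Lemma wilton_series_dist n m t :
  (`|wilton_series t (n + m)%N - wilton_series t n|%:E <= wtail n t)%E.
Proof.
have -> : wilton_series t (n + m)%N - wilton_series t n =
    \sum_(0 <= k < m) (-1) ^+ (n + k)%N * wgamma (n + k)%N (frac_part t).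
  rewrite /wilton_series sub_series_geq ?leq_addr//.
  rewrite -{1}(add0n n) big_addn addKn.
  by apply: eq_bigr => k _; rewrite addnC.
apply: (@le_trans _ _ (\sum_(0 <= k < m) (wgamma (n + k)%N (frac_part t))%:E)%E).
  rewrite sumEFin lee_fin; apply: (le_trans (ler_norm_sum _ _ _)).
  apply: ler_sum => k _.
  by rewrite normrM normrX normrN1 expr1n mul1r ger0_norm// wgamma_ge0.
by apply: nneseries_lim_ge => k _ _; rewrite lee_fin wgamma_ge0.
Qed.

Lemma wilton_cvg t : wilton_number t -> wilton_series t @ \oo --> wilton t.
Proof. by move=> wt; rewrite /wilton mem_set//; case: wt. Qed.

Lemma wilton_tail n t : wilton_number t ->
  (`|wilton t - wilton_series t n|%:E <= wtail n t)%E.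
Proof.
move=> wt; have := wtail_ge0 n t.
have := wilton_series_dist n ^~ t.
case: (wtail n t) => [r| |] // H _; last by rewrite leey.
rewrite lee_fin.
have : `|wilton_series t k - wilton_series t n| @[k --> \oo] -->
    `|wilton t - wilton_series t n|.
  by apply: cvg_norm; apply: cvgB; [exact: wilton_cvg|exact: cvg_cst].
move/cvgr_to_le; apply; near=> k.
have nk : (n <= k)%N by near: k; exact: nbhs_infty_ge.
by have := H (k - n)%N; rewrite subnKC.
Unshelve. all: by end_near. Qed.

(** Off the Wilton numbers the function is [0], so that this bound, unlike the bounds on
    tails, holds everywhere. *)
Lemma normr_wilton_le t : (`|wilton t|%:E <= wtail 0 t)%E.
Proof.
have [wt|nwt] := pselect (wilton_number t).
  by have := wilton_tail 0 t wt; rewrite /wilton_series /series/= big_geq// subr0.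
by rewrite /wilton memNset// normr0 wtail_ge0.
Qed.

Lemma measurable_rational : measurable (@rational R).
Proof.
apply: countable_measurable; first by move=> t; exact: measurable_set1.
exact: sub_countable (card_image_le _ _) (countableP _).
Qed.

Lemma rational_measure0 : mu (@rational R) = 0%E.
Proof.
apply: countable_lebesgue_measure0.
exact: sub_countable (card_image_le _ _) (countableP _).
Qed.

Lemma cset_root_cell (i : int) : cset (root_cell i) = `]i%:~R, (i%:~R + 1)[%classic :> set R.
Proof.
by apply/seteqP; split => t; rewrite /cset/= in_itv/= => /andP[h1 h2];
  apply/andP; split; lra.
Qed.

Lemma integral_wtail_root (i : int) :
  (\int[mu]_(t in cset (root_cell i)) wtail 0 t <= 32%:E)%E.
Proof.
have H := @root_cellP R i.
have := integral_wgamma_tail 0 0 _ (cset (root_cell i)) 0 1 H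
  (measurable_cset _ _ H) (@subset_refl _ _) (lexx _).
rewrite mul0e add0e oppr0 expR0 /clen/= addr0 !mulr1 invr1 mulr1.
rewrite -EFinM (_ : 8 * 4 = 32); last by ring.
apply => // t _; by rewrite /beta_pred big_ord0.
Qed.

Lemma ae_wilton_number (i : int) (I : set R) : measurable I ->
  I `<=` cset (root_cell i) ->
  {ae mu, forall t, I t -> wilton_number t}.
Proof.
move=> mI Ic; have H := @root_cellP R i; have mc := measurable_cset _ _ H.
have : mu.-integrable (cset (root_cell i)) (wtail 0).
  apply/integrableP; split; first by apply: measurable_funTS; exact: measurable_wtail.
  under eq_integral do rewrite gee0_abs ?wtail_ge0//.
  by apply: le_lt_trans (integral_wtail_root i) _; rewrite ltry.
move=> h0; have h1 := @integrable_ae _ _ R mu _ mc _ h0.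
have h2 : {ae mu, forall t, irrational t}.
  exists (@rational R); split; [exact: measurable_rational|exact: rational_measure0|].
  by move=> t /= h; apply: contrapT.
apply: filterS2 h1 h2 => t h1 h2 /Ic/h1 fin; apply: wilton_number_wtail => //.
by rewrite ltey_eq fin.
Qed.

Lemma integral_wtail_itv (i : int) m :
  (\int[mu]_(t in `](i%:~R)%R, (i%:~R + m%:R)%R]) wtail 0 t <= (32 * m%:R)%:E)%E.
Proof.
elim: m => [|m IH]; first by rewrite addr0 set_itv_ge ?bnd_simp ?ltxx// integral_set0 mulr0.
rewrite (@itv_bndbnd_setU _ _ _ (BRight (i%:~R + m%:R))); last 2 first.
- by rewrite bnd_simp lerDl.
- by rewrite bnd_simp lerD2l ler_nat.
rewrite ge0_integral_setU//; last 3 first.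
- by apply: measurable_funTS; exact: measurable_wtail.
- by move=> t _; exact: wtail_ge0.
- by apply/disj_setPRL => t /=; rewrite !in_itv/= => /andP[h _]; rewrite leNgt h andbF.
rewrite -natr1 mulrDr mulr1 EFinD leeD//.
rewrite -integral_itv_bndo_bndc; last by apply: measurable_funTS; exact: measurable_wtail.
have := integral_wtail_root (i + m%:Z).
by rewrite cset_root_cell intrD -addrA.
Qed.

Lemma integral_wtail_bounded (M : R) : (\int[mu]_(t in `[(- M)%R, M]) wtail 0 t < +oo)%E.
Proof.
pose n := (Num.truncn M).+1.
have Mn : M < n%:R by exact: truncnS_gt.
apply: (@le_lt_trans _ _ (\int[mu]_(t in `]((- n%:Z)%:~R)%R,
    ((- n%:Z)%:~R + (n + n)%:R)%R]) wtail 0 t)%E).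
  apply: ge0_subset_integral => //.
  - by apply: measurable_funTS; exact: measurable_wtail.
  - by move=> t _; exact: wtail_ge0.
  - move=> t /=; rewrite !in_itv/= mulrNz natrD -[n%:Z%:~R]/(n%:R : R) => /andP[h1 h2].
    by apply/andP; split; lra.
by apply: le_lt_trans (integral_wtail_itv _ _) _; rewrite ltry.
Qed.

Lemma measurable_wilton_series n : measurable_fun setT (fun t : R => wilton_series t n).
Proof.
rewrite /wilton_series /series/=; apply: measurable_sum => k.
by apply: measurable_funM => //; exact: measurable_wgamma.
Qed.

Lemma cvg_series_cauchyP (u : R^nat) : cvgn u <->
  forall k, exists N, forall n, `|u (N + n)%N - u N| < k.+1%:R^-1.
Proof.
split=> [/cvg_ex[l ul] k|H].
  have e0 : 0 < k.+1%:R^-1 / 2 :> R by rewrite divr_gt0// invr_gt0.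
  have [N _ HN] := cvgr_distC_lt _ _ ul _ e0.
  exists N => n; have /= h1 := HN N (leqnn _); have /= h2 := HN (N + n)%N (leq_addr _ _).
  have -> : u (N + n)%N - u N = (u (N + n)%N - l) - (u N - l) by ring.
  by apply: (le_lt_trans (ler_normB _ _)); rewrite [ltRHS]splitr ltrD.
apply: cauchy_cvg; apply: cauchy_exP => e e0.
have [k _ ke] : \forall k \near \oo, k.+1%:R^-1 < e.
  apply: filterS (cvgr_dist_lt _ _ (@cvg_harmonic R) _ e0) => k /=.
  by rewrite sub0r normrN ger0_norm.
have [N HN] := H k; exists (u N), N => // n /= Nn.
rewrite /ball/= distrC; have := HN (n - N)%N; rewrite subnKC// => /lt_trans; apply.
exact: ke k (leqnn k).
Qed.

(** The Cauchy criterion with rational tolerances writes convergence by countable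
    operations. *)
Lemma measurable_wilton_number : measurable (@wilton_number R).
Proof.
rewrite (_ : @wilton_number R = ~` rational `&` \bigcap_k \bigcup_N \bigcap_n
  [set t | `|wilton_series t (N + n)%N - wilton_series t N| < k.+1%:R^-1]).
  apply: measurableI; first by apply: measurableC; exact: measurable_rational.
  apply: bigcap_measurable => // k _; apply: bigcup_measurable => N _.
  apply: bigcap_measurable => // n _.
  rewrite -[X in measurable X]setTI.
  have mf : measurable_fun setT
      (fun t : R => `|wilton_series t (N + n)%N - wilton_series t N|).
    by apply: measurableT_comp => //; apply: measurable_funB;
      exact: measurable_wilton_series.
  have := mf measurableT `]-oo, k.+1%:R^-1[%classic (measurable_itv _).
  by congr measurable; apply/seteqP; split => t /=; rewrite in_itv/=.
apply/seteqP; split => t.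
  move=> [it /cvg_series_cauchyP h]; split => // k _.
  by have [N hN] := h k; exists N => // n _; exact: hN.
move=> [it h]; split => //; apply/cvg_series_cauchyP => k.
by have [N _ hN] := h k I; exists N => n; exact: hN n I.
Qed.

Lemma measurable_wilton : measurable_fun setT (@wilton R).
Proof.
apply: (@measurable_fun_cvg _ _ _ setT
    (fun n t => \1_(@wilton_number R) t * wilton_series t n)).
  move=> n; apply: measurable_funM; last exact: measurable_wilton_series.
  by apply: measurable_indic; exact: measurable_wilton_number.
move=> t _; have [wt|nwt] := pselect (wilton_number t).
  rewrite indicE mem_set//=; under eq_fun do rewrite mul1r.
  exact: wilton_cvg.
rewrite indicE memNset// /wilton memNset//=; under eq_fun do rewrite mul0r.
exact: cvg_cst.
Qed.

Lemma locally_integrable_wilton : locally_integrable setT (@wilton R).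
Proof.
split; [exact: measurable_wilton|exact: openT|move=> K _ cK].
have [M [_ HM]] := compact_bounded cK.
have MM : M < M + 1 by lra.
apply: le_lt_trans (integral_wtail_bounded (M + 1)).
have mK : measurable K by apply: compact_measurable.
apply: (@le_trans _ _ (\int[mu]_(t in K) wtail 0 t)%E).
  apply: ge0_le_integral => //.
  - by apply/measurable_EFinP; apply: measurableT_comp => //;
      apply: measurable_funTS; exact: measurable_wilton.
  - by apply: measurable_funTS; exact: measurable_wtail.
  - by move=> t _; exact: normr_wilton_le.
apply: ge0_subset_integral => //.
- by apply: measurable_funTS; exact: measurable_wtail.
- by move=> t _; exact: wtail_ge0.
- by move=> t Kt /=; rewrite in_itv/= -ler_norml; exact: (HM _ MM t Kt).
Qed.

End wilton_integrability.

(** * Means of single terms over an interval inside a cell *)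

Section interval_estimates.
Context {R : realType}.
Local Notation mu := (@lebesgue_measure R).
Implicit Types (a b t x M : R) (n k : nat) (c : cell R).

Lemma ln_4M_le (r : R) : 0 < r -> ln (2 * (2 * r)) <= 2 + ln r.
Proof.
move=> r0; rewrite lnM ?posrE ?mulr_gt0// lnM ?posrE//.
by have := @ln2_le1 R; lra.
Qed.

Lemma lebesgue_measure_itvcc a b : a < b -> mu `[a, b] = (b - a)%:E.
Proof. by move=> ab; rewrite lebesgue_measure_itv/= lte_fin ab EFinN. Qed.

Lemma itv_le_clen n c a b : is_cell n c -> a < b -> `[a, b] `<=` cset c ->
  b - a <= clen c.
Proof.
move=> H ab sub; rewrite -lee_fin -(lebesgue_measure_cset _ _ H).
rewrite -lebesgue_measure_itvcc//; apply: le_measure; rewrite ?inE//.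
exact: measurable_cset H.
Qed.

Lemma log_cellE n c a b : is_cell n c -> a < b -> `[a, b] `<=` cset c ->
  ((ln (clen c / (b - a)))%:E * mu `[a, b] +
    (4 * expR (- ln (clen c / (b - a))) * clen c)%:E =
   ((b - a) * (ln (clen c / (b - a)) + 4))%:E)%E.
Proof.
move=> H ab sub; rewrite lebesgue_measure_itvcc//.
have D0 := clen_gt0 _ _ H; have L0 : 0 < b - a by lra.
rewrite expRN lnK ?posrE ?divr_gt0// -EFinM -EFinD; congr EFin.
by field; rewrite !gt_eqF.
Qed.

Lemma ln_clen_ge0 n c a b : is_cell n c -> a < b -> `[a, b] `<=` cset c ->
  0 <= ln (clen c / (b - a)).
Proof.
move=> H ab sub; rewrite ln_ge0// ler_pdivlMr ?mul1r; last lra.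
exact: itv_le_clen H ab sub.
Qed.

(** If [beta_n >= beta_n(x) / 2] on the interval, then [gamma_n] is comparable there to its
    value at [x].  Otherwise the length of the interval is at least
    [beta_n(x) / (2 q_n)], and [ln (D / h)] exceeds
    [ln (1 / alpha_n(x))] at most by a constant. *)
Lemma integral_wgamma_itv n c a b x : is_cell n c -> a < b ->
  `[a, b] `<=` cset c -> x \in `[a, b] ->
  (\int[mu]_(t in `[a, b]) (wgamma n (frac_part t))%:E <=
   ((b - a) * (6 / cden c + 2 * wgamma n (frac_part x)))%:E)%E.
Proof.
move=> H ab sub xab; have q0 := cden_gt0 _ _ H.
have L0 : 0 < b - a by lra.
have D0 := clen_gt0 _ _ H; have Dq := clen_le _ _ H.
have cx : cset c x by exact: sub.
have u1 := crem_prev_le _ _ _ H cx; have u2 := crem_prev_ge _ _ _ H cx.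
have /andP[v0 vu] := cx; have u0 := lt_trans v0 vu.
have gE := wgamma_cell _ _ _ H cx.
have qi0 : 0 < (cden c)^-1 by rewrite invr_gt0.
have key : (cden c)^-1 * ln (2 / (cden c * crem c x)) <=
    2 / cden c + 2 * wgamma n (frac_part x).
  have l0 : 0 <= ln (crem_prev c x / crem c x).
    by rewrite ln_ge0// ler_pdivlMr// mul1r ltW.
  have p4 : 0 < 2 * (2 * (crem_prev c x / crem c x)).
    by rewrite !mulr_gt0// invr_gt0.
  have : ln (2 / (cden c * crem c x)) <= 2 + ln (crem_prev c x / crem c x).
    apply: (@le_trans _ _ (ln (2 * (2 * (crem_prev c x / crem c x))))).
      rewrite ler_ln ?posrE//; last by rewrite divr_gt0// mulr_gt0.
      rewrite ler_pM2l// invfM mulrA ler_pM2r ?invr_gt0//.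
      by move: u2; rewrite invfM; lra.
    by apply: ln_4M_le; rewrite divr_gt0.
  move/(ler_wpM2l (ltW qi0)) => /le_trans; apply.
  rewrite mulrDr mulrC lerD2l gE mulrA ler_wpM2r//.
  by move: u2; rewrite invfM; lra.
have [h|h] := pselect (forall t, t \in `[a, b] -> crem c x / 2 <= crem c t).
- apply: (@le_trans _ _ (\int[mu]_(t in `[a, b])
     (cst (2 / cden c + 2 * wgamma n (frac_part x))%:E t))%E).
    apply: ge0_le_integral => //.
    + by move=> t _; rewrite lee_fin wgamma_ge0.
    + apply/measurable_EFinP; apply: measurable_funTS; exact: measurable_wgamma.
    + move=> t tab; rewrite lee_fin; apply: le_trans key.
      have ct := sub _ tab; rewrite (wgamma_cell _ _ _ H ct).
      have w1 := crem_prev_le _ _ _ H ct.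
      have /andP[w0 wu] := ct.
      apply: ler_pM => //.
      * by rewrite (le_trans (ltW w0))// ltW.
      * by rewrite ln_ge0// ler_pdivlMr// mul1r ltW.
      have hx := h t tab.
      rewrite ler_ln ?posrE; last 2 first.
      * by rewrite divr_gt0// (lt_trans w0).
      * by rewrite divr_gt0// mulr_gt0.
      rewrite ler_pdivrMr//; apply: (le_trans w1).
      rewrite [leRHS](_ : _ = (cden c)^-1 * (2 * crem c t / crem c x)).
        by rewrite ler_peMr ?(ltW qi0)// ler_pdivlMr// mul1r; lra.
      by field; rewrite !gt_eqF.
  rewrite integral_cst// -[X in (_ * X)%E]/(mu `[a, b]).
  rewrite lebesgue_measure_itvcc// -EFinM lee_fin mulrC.
  by rewrite ler_wpM2l ?(ltW L0)//; lra.
- move/existsNP : h => [t /not_implyP[tab /negP]]; rewrite -ltNge => h.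
  have Lv : crem c x <= 2 * cden c * (b - a).
    have := crem_dist _ _ t x H.
    have : `|x - t| <= b - a.
      by move: tab xab; rewrite !in_itv/= ler_norml => /andP[? ?] /andP[? ?];
        apply/andP; split; lra.
    move=> /(ler_wpM2l (ltW q0)); have := ler_norm (crem c x - crem c t); lra.
  have := integral_wgamma n 0 c `[a, b] (ln (clen c / (b - a))) (cden c)^-1 H
    (measurable_itv _) sub (ln_clen_ge0 _ _ _ _ H ab sub).
  rewrite !addn0 (log_cellE _ _ _ _ H ab sub).
  move=> /(_ _ (ltW qi0)) /le_trans; apply.
    move=> s sab; rewrite (beta_pred_cell _ _ H); last exact: sub.
    by apply: (crem_prev_le _ _ _ H); exact: sub.
  rewrite lee_fin mulrCA ler_wpM2l ?(ltW L0)//.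
  have : ln (clen c / (b - a)) <= ln (2 / (cden c * crem c x)).
    rewrite ler_ln ?posrE ?divr_gt0 ?mulr_gt0//.
    rewrite ler_pdivrMr// [leRHS]mulrAC ler_pdivlMr ?mulr_gt0//.
    apply: (@le_trans _ _ (clen c * (cden c * (2 * cden c * (b - a))))).
      by rewrite ler_wpM2l ?(ltW D0)// ler_wpM2l ?(ltW q0).
    nra.
  move/(ler_wpM2l (ltW qi0)); lra.
Qed.

End interval_estimates.

(** * Mean oscillation of the Wilton function *)

Section wilton_mean_oscillation.
Context {R : realType}.
Local Notation mu := (@lebesgue_measure R).
Implicit Types (a b t x : R) (n k : nat).

(** On the interval [beta_n] is at most [beta_n(x) + q_n h], and the two summands are
    multiplied with [ln (D / h)]: the first one is the matter of [escape_wgamma], the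
    second one is bounded since [h ln (D / h) <= D <= 1 / q_n^2]. *)
Lemma integral_wtail_itv_le x n a b : irrational x -> a < b ->
  `[a, b] `<=` cset (cell_at x n) -> ~ (`[a, b] `<=` cset (cell_at x n.+1)) ->
  x \in `[a, b] ->
  (\int[mu]_(t in `[a, b]) wtail n.+1 t <=
   ((b - a) * (8 * (13 / cden (cell_at x n) + wgamma n.+1 (frac_part x)
     + 2 * wgamma n.+2 (frac_part x))))%:E)%E.
Proof.
move=> ix ab sub nsub xab.
have [H cx p0] := cell_atP x n ix; have [_ _ p1] := cell_atP x n.+1 ix.
have [_ ex _] := cell_atP x n.+2 ix.
set c := cell_at x n in H cx sub *.
have q0 := cden_gt0 _ _ H; have L0 : 0 < b - a by lra.
have D0 := clen_gt0 _ _ H; have Dq := clen_le _ _ H.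
have LD := itv_le_clen _ _ _ _ H ab sub.
have dist t : t \in `[a, b] -> `|t - x| <= b - a.
  by move: xab; rewrite !in_itv/= ler_norml => /andP[? ?] /andP[? ?];
    apply/andP; split; lra.
have /existsNP[t /not_implyP[tab ndt]] := nsub.
have [tx esc] := escape_wgamma n c _ _ x t H p0 p1 ex ndt.
have /andP[v0 vu] := cx.
have qi0 : 0 < (cden c)^-1 by rewrite invr_gt0.
have vq : crem c x <= (cden c)^-1.
  by apply: le_trans (crem_prev_le _ _ _ H cx); exact: ltW.
(* A bound for [beta_n] on the interval, as its slope is [q_n]. *)
pose M := crem c x + cden c * (b - a).
have M0 : 0 <= M by rewrite addr_ge0 ?mulr_ge0// ltW.
have := integral_wgamma_tail n 1 c `[a, b] (ln (clen c / (b - a))) M H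
  (measurable_itv _) sub (ln_clen_ge0 _ _ _ _ H ab sub).
rewrite !addn1 (log_cellE _ _ _ _ H ab sub).
move=> /(_ _ M0) /le_trans; apply.
  move=> s sab; have cs := sub _ sab.
  rewrite beta_predS (beta_pred_cell _ _ H _ cs) (alpha_cell _ _ H _ cs).
  have /andP[s0 su] := cs.
  rewrite mulrC divfK; last by rewrite gt_eqF// (lt_trans s0).
  have := crem_dist _ _ x s H; have := dist s sab.
  move=> /(ler_wpM2l (ltW q0)); have := ler_norm (crem c s - crem c x).
  by rewrite /M; lra.
rewrite lee_fin mulrCA ler_wpM2l ?(ltW L0)//.
rewrite -mulrA ler_wpM2l//.
set l := ln (clen c / (b - a)).
have h1 : crem c x * l <= crem c x * ln (clen c / `|t - x|).
  rewrite ler_wpM2l ?(ltW v0)// /l ler_ln ?posrE ?divr_gt0//.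
  by rewrite ler_pM2l// lef_pV2 ?posrE// dist.
have qL : cden c * (b - a) <= (cden c)^-1.
  rewrite -[leRHS]mul1r ler_pdivlMr//; apply: le_trans Dq.
  rewrite [leLHS](_ : _ = (b - a) * cden c ^+ 2); last by ring.
  by rewrite ler_wpM2r ?sqr_ge0.
have h2 : cden c * (b - a) * l <= (cden c)^-1.
  apply: (@le_trans _ _ (cden c * clen c)).
    rewrite -mulrA ler_wpM2l ?(ltW q0)//.
    have : l <= clen c / (b - a).
      apply: (le_trans (ln_le_subr1 _ _)); first by rewrite divr_gt0.
      by lra.
    move/(ler_wpM2l (ltW L0))/le_trans; apply.
    by rewrite mulrCA divff ?gt_eqF// mulr1.
  rewrite -[leRHS]mul1r ler_pdivlMr//; apply: le_trans Dq.
  by rewrite le_eqVlt; apply/orP; left; apply/eqP; ring.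
rewrite /M mulrDl mulrDr (mulrDr (_ * _)).
lra.
Qed.

(** The constants are those of [sum_wgamma_dist], [integral_wgamma_itv] and
    [integral_wtail_itv_le] put together: [128 = 18 + 6 + 8 * 13], [3 = 1 + 2] and
    [16 = 8 * 2]. *)
Definition wilton_error x n : R :=
  `|wilton_series x n.+1 - wilton x| + 128 / cden (cell_at x n) +
  3 * wgamma n (frac_part x) + 8 * wgamma n.+1 (frac_part x) +
  16 * wgamma n.+2 (frac_part x).

Lemma wilton_dist_le x n t : irrational x -> wilton_number t ->
  cset (cell_at x n) t ->
  (`|wilton t - wilton x|%:E <=
   (`|wilton_series x n.+1 - wilton x| +
    18 * cden (cell_at x n) * `|t - x| + wgamma n (frac_part x))%:E +
   (wgamma n (frac_part t))%:E + wtail n.+1 t)%E.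
Proof.
move=> ix wt ct; rewrite -EFinD [leRHS]addeC.
apply: (@le_trans _ _ (`|wilton t - wilton_series t n.+1| +
   (`|wilton_series x n.+1 - wilton x| +
    18 * cden (cell_at x n) * `|t - x| + wgamma n (frac_part x) +
     wgamma n (frac_part t)))%:E); last first.
  by rewrite [leLHS]EFinD leeD2r//; exact: wilton_tail.
rewrite lee_fin.
have -> : wilton t - wilton x = (wilton t - wilton_series t n.+1) +
  ((wilton_series t n.+1 - wilton_series x n.+1) +
   (wilton_series x n.+1 - wilton x)) by ring.
apply: (le_trans (ler_normD _ _)); rewrite lerD2l.
apply: (le_trans (ler_normD _ _)).
have : `|wilton_series t n.+1 - wilton_series x n.+1| <=
    18 * cden (cell_at x n) * `|t - x| + (wgamma n (frac_part t) + wgamma n (frac_part x)).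
  rewrite /wilton_series /series/= -sumrB big_nat_recr//=.
  apply: (le_trans (ler_normD _ _)); apply: lerD.
    apply: (le_trans (ler_norm_sum _ _ _)).
    apply: le_trans (sum_wgamma_dist x n t ix ct).
    apply: ler_sum => k _.
    by rewrite -mulrBr normrM normrX normrN1 expr1n mul1r.
  rewrite -mulrBr normrM normrX normrN1 expr1n mul1r.
  by apply: (le_trans (ler_normB _ _)); rewrite !ger0_norm ?wgamma_ge0.
lra.
Qed.

Lemma cell_at_root x n : irrational x ->
  cset (cell_at x n) `<=` cset (root_cell (Num.floor x)).
Proof. by move=> ix; rewrite -[n]add0n; exact: cell_at_sub. Qed.

Lemma integral_wilton_dist x n a b : irrational x -> a < b ->
  `[a, b] `<=` cset (cell_at x n) -> ~ (`[a, b] `<=` cset (cell_at x n.+1)) ->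
  x \in `[a, b] ->
  (\int[mu]_(t in `[a, b]) `|wilton t - wilton x|%:E <=
   ((b - a) * wilton_error x n)%:E)%E.
Proof.
move=> ix ab sub nsub xab.
have [H cx p0] := cell_atP x n ix; have q0 := cden_gt0 _ _ H.
have L0 : 0 < b - a by lra.
have Dq := clen_le _ _ H; have LD := itv_le_clen _ _ _ _ H ab sub.
pose K := `|wilton_series x n.+1 - wilton x| + 18 / cden (cell_at x n)
  + wgamma n (frac_part x).
have g0 := @wgamma_ge0 R.
have K0 : 0 <= K by rewrite !addr_ge0// divr_ge0// ltW.
have mg : measurable_fun `[a, b] (fun t => (wgamma n (frac_part t))%:E : \bar R).
  by apply/measurable_EFinP; apply: measurable_funTS; exact: measurable_wgamma.
have mt : measurable_fun `[a, b] (wtail n.+1 : R -> \bar R).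
  by apply: measurable_funTS; exact: measurable_wtail.
apply: (@le_trans _ _ (\int[mu]_(t in `[a, b])
   (K%:E + (wgamma n (frac_part t))%:E + wtail n.+1 t))%E).
  apply: ae_ge0_le_integral => //.
  - apply/measurable_EFinP; apply: measurableT_comp => //.
    apply: measurable_funB => //.
    by apply: measurable_funTS; exact: measurable_wilton.
  - by move=> t _; rewrite !adde_ge0// ?lee_fin// wtail_ge0.
  - by apply: emeasurable_funD => //; exact: emeasurable_funD.
  have sub0 := subset_trans sub (cell_at_root x n ix).
  have := ae_wilton_number (Num.floor x) `[a, b] (measurable_itv _) sub0.
  apply: (@filterS _ _ (ae_filter_ringOfSetsType mu)) => t h tab; have ct := sub _ tab.
  apply: (le_trans (wilton_dist_le x n t ix (h tab) ct)).
  rewrite leeD2r// leeD2r// lee_fin /K lerD2r lerD2l -mulrA ler_wpM2l//.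
  apply: (@le_trans _ _ (cden (cell_at x n) * (b - a))).
    rewrite ler_wpM2l ?(ltW q0)//; move: xab tab; rewrite /= !in_itv/= ler_norml.
    by move=> /andP[? ?] /andP[? ?]; apply/andP; split; lra.
  rewrite -[leRHS]mul1r ler_pdivlMr//; apply: le_trans Dq.
  rewrite [leLHS](_ : _ = (b - a) * cden (cell_at x n) ^+ 2); last by ring.
  by rewrite ler_wpM2r ?sqr_ge0.
rewrite ge0_integralD//; last 3 first.
- by move=> t _; rewrite adde_ge0// lee_fin.
- exact: emeasurable_funD.
- by move=> t _; exact: wtail_ge0.
rewrite ge0_integralD//; last by move=> t _; rewrite lee_fin.
rewrite integral_cst// -[X in (_ * X)%E]/(mu `[a, b]) lebesgue_measure_itvcc//.
have h1 := integral_wgamma_itv n _ a b x H ab sub xab.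
have h2 := integral_wtail_itv_le x n a b ix ab sub nsub xab.
apply: (le_trans (leeD (leeD2l _ h1) h2)).
rewrite -EFinM -!EFinD lee_fin /wilton_error /K.
rewrite le_eqVlt; apply/orP; left; apply/eqP; field; rewrite gt_eqF//.
Qed.

End wilton_mean_oscillation.

(** * Lebesgue points and the derivative of the primitive *)

Section lebesgue_points.
Context {R : realType}.
Local Notation mu := (@lebesgue_measure R).
Implicit Types (a b t x h : R) (n k : nat).

Lemma wgamma_cvg0 x : wilton_number x ->
  wgamma n (frac_part x) @[n --> \oo] --> (0 : R).
Proof.
move=> [_ /cvg_series_cvg_0 /cvgr0Pnorm_le H]; apply/cvgr0Pnorm_le => e e0.
have := H e e0; apply: filterS => n.
by rewrite normrM normrX normrN1 expr1n mul1r.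
Qed.

Lemma wilton_error_cvg0 x : wilton_number x ->
  wilton_error x n @[n --> \oo] --> (0 : R).
Proof.
move=> wx; have ix : irrational x by case: wx.
have g0 := wgamma_cvg0 x wx.
have g1 : wgamma n.+1 (frac_part x) @[n --> \oo] --> (0 : R).
  by rewrite (cvg_shiftS (fun n => wgamma n (frac_part x))).
have g2 : wgamma n.+2 (frac_part x) @[n --> \oo] --> (0 : R).
  by rewrite (cvg_shiftS (fun n => wgamma n.+1 (frac_part x))).
have s0 : `|wilton_series x n.+1 - wilton x| @[n --> \oo] --> (0 : R).
  rewrite (cvg_shiftS (fun n => `|wilton_series x n - wilton x|)).
  have : `|wilton_series x n - wilton x| @[n --> \oo] -->
      `|wilton x - wilton x|.
    by apply: cvg_norm; apply: cvgB; [exact: wilton_cvg|exact: cvg_cst].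
  by rewrite subrr normr0.
have := cvgD (cvgD (cvgD (cvgD s0 (cvgMl_tmp (a := 128) (inv_cden_cvg0 x ix)))
  (cvgMl_tmp (a := 3) g0)) (cvgMl_tmp (a := 8) g1)) (cvgMl_tmp (a := 16) g2).
rewrite !mulr0 !addr0; exact.
Qed.

(** The lengths of the cells tend to [0], so that the interval leaves them. *)
Lemma exit_cell x N a b : irrational x -> a < b ->
  `[a, b] `<=` cset (cell_at x N) ->
  exists n, [/\ (N <= n)%N, `[a, b] `<=` cset (cell_at x n) &
    ~ (`[a, b] `<=` cset (cell_at x n.+1))].
Proof.
move=> ix ab subN; apply: contrapT => /forallNP H.
have sub k : `[a, b] `<=` cset (cell_at x (N + k)).
  elim: k => [|k IH]; first by rewrite addn0.
  rewrite addnS; apply: contrapT => nsub; apply: (H (N + k)%N).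
  by split => //; exact: leq_addr.
have L0 : 0 < b - a by lra.
(* By [cden_at_ge] this makes [q_(N+k) > 1 / (b - a)], against
   [b - a <= 1 / q_(N+k)^2] and [q_(N+k) >= 1]. *)
pose k := Num.truncn (3 / (b - a)).
have [Hc _ _] := cell_atP x (N + k) ix.
have q0 := cden_gt0 _ _ Hc; have q1 := cden_ge1 _ _ Hc.
have LD := itv_le_clen _ _ _ _ Hc ab (sub k); have Dq := clen_le _ _ Hc.
have : 3 / (b - a) < 3 * cden (cell_at x (N + k)).
  apply: (lt_le_trans (truncnS_gt _)); apply: le_trans (cden_at_ge _ _ ix).
  by rewrite ler_nat ltnS leq_addl.
rewrite ltr_pdivrMr//.
have : (b - a) * cden (cell_at x (N + k)) ^+ 2 <= 1.
  by apply: le_trans Dq; rewrite ler_wpM2r ?sqr_ge0.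
rewrite expr2; nra.
Qed.

Lemma cset_nbhs n c x : is_cell n c -> cset c x ->
  exists2 d, 0 < d & forall t, `|t - x| < d -> cset c t.
Proof.
move=> H /andP[v0 vu]; have q0 := cden_gt0 _ _ H.
(* Both remainders are affine with slopes at most [cden c] in absolute value. *)
exists (Num.min (crem c x) ((crem_prev c x - crem c x) / 2) / cden c).
  by rewrite divr_gt0// lt_min v0 divr_gt0// subr_gt0.
move=> t; rewrite ltr_pdivlMr// mulrC -(crem_dist _ _ x t H) lt_min => /andP[h1 h2].
have h3 : `|crem_prev c t - crem_prev c x| <= `|crem c t - crem c x|.
  rewrite (crem_dist _ _ x t H) (crem_prev_dist _ _ x t H) ler_wpM2r//.
  exact: cden_prev_le H.
move: h1 h2 h3; rewrite ltr_norml => /andP[h1 h1'].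
rewrite ltr_norml => /andP[h2 h2'] h3.
have : `|crem_prev c t - crem_prev c x| < (crem_prev c x - crem c x) / 2.
  by apply: (le_lt_trans h3); rewrite ltr_norml h2.
rewrite ltr_norml => /andP[h4 h5].
by rewrite /cset/=; apply/andP; split; lra.
Qed.

Lemma wilton_mean_oscillation x (e : R) : wilton_number x -> 0 < e ->
  exists2 d, 0 < d & forall a b, a < b -> x \in `[a, b] -> b - a < d ->
    (\int[mu]_(t in `[a, b]) `|wilton t - wilton x|%:E <= ((b - a) * e)%:E)%E.
Proof.
move=> wx e0; have ix : irrational x by case: wx.
have /cvgr0Pnorm_le/(_ _ e0)[N _ HN] := wilton_error_cvg0 x wx.
have [H cx _] := cell_atP x N ix.
have [d d0 Hd] := cset_nbhs _ _ _ H cx.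
exists d => // a b ab xab bad.
have sub : `[a, b] `<=` cset (cell_at x N).
  move=> t tab; apply: Hd; apply: le_lt_trans bad.
  move: xab tab; rewrite /= !in_itv/= ler_norml => /andP[? ?] /andP[? ?].
  by apply/andP; split; lra.
have [n [Nn subn nsub]] := exit_cell _ _ _ _ ix ab sub.
apply: (le_trans (integral_wilton_dist x n a b ix ab subn nsub xab)).
rewrite lee_fin ler_wpM2l//; first by rewrite subr_ge0 ltW.
exact: le_trans (ler_norm _) (HN n Nn).
Qed.

Lemma oriented_integral_norm (f : R -> R) x h :
  (forall t, 0 <= f t) -> h != 0 ->
  `|h^-1 * oriented_integral f x (x + h)| =
  `|h|^-1 * \int[mu]_(t in `[Num.min x (x + h), Num.max x (x + h)]) f t.
Proof.
move=> f0 h0; rewrite normrM normfV; congr (_ * _); rewrite /oriented_integral.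
have i0 (D : set R) : 0 <= \int[mu]_(t in D) f t.
  by apply: Rintegral_ge0 => t _.
by case: leP => h1; rewrite ?normrN ger0_norm.
Qed.

Lemma lebesgue_point_wilton x : wilton_number x -> lebesgue_point (@wilton R) x.
Proof.
move=> wx; split; first exact: locally_integrable_wilton.
apply/cvgr0Pnorm_le => e e0.
have [d d0 Hd] := wilton_mean_oscillation x e wx e0.
near=> h.
have h0 : h != 0 by near: h; exact: nbhs_dnbhs_neq.
have hd : `|h| < d by near: h; exact: dnbhs0_lt.
rewrite oriented_integral_norm//.
set a := Num.min _ _; set b := Num.max _ _.
have hE : b - a = `|h|.
  rewrite /a /b; case: leP => h1; last by rewrite ltr0_norm; lra.
  by rewrite ger0_norm; lra.
have ab : a < b by rewrite -subr_gt0 hE normr_gt0.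
have xab : x \in `[a, b].
  by rewrite in_itv/= /a /b ge_min le_max !lexx.
have ba : b - a < d by rewrite hE.
have := Hd a b ab xab ba; rewrite hE => H.
rewrite mulrC ler_pdivrMr ?normr_gt0// mulrC -lee_fin /Rintegral fineK//.
rewrite ge0_fin_numE ?integral_ge0//.
exact: le_lt_trans H (ltry _).
Unshelve. all: by end_near. Qed.

Lemma locally_integrable_itv (f : R -> R) a b : locally_integrable setT f ->
  mu.-integrable `[a, b] (EFin \o f).
Proof.
move=> [mf _ Kf]; apply/integrableP; split.
  by apply/measurable_EFinP; exact: measurable_funTS.
by apply: Kf => //; exact: segment_compact.
Qed.

Lemma integral_increment (f : R -> R) (c : R) a b :
  locally_integrable setT f -> 0 <= a -> a <= b ->
  `|oriented_integral f 0 b - oriented_integral f 0 a - (b - a) * c| <=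
  \int[mu]_(t in `[a, b]) `|f t - c|.
Proof.
move=> lf a0 ab; rewrite /oriented_integral a0 (le_trans a0 ab).
have int0b := locally_integrable_itv _ 0 b lf.
have intab := locally_integrable_itv _ a b lf.
rewrite Rintegral_itvB// ?bnd_simp//.
rewrite Rintegral_itv_obnd_cbnd; last first.
  apply: integrableS intab => //.
  by move=> t /=; rewrite !in_itv/= => /andP[/ltW -> ->].
have intc : mu.-integrable `[a, b] (EFin \o cst c).
  apply: continuous_compact_integrable; first exact: segment_compact.
  by apply: continuous_subspaceT => t; exact: cst_continuous.
have -> : (b - a) * c = \int[mu]_(t in `[a, b]) (cst c t).
  have muab : mu `[a, b] = (b - a)%:E.
    rewrite lebesgue_measure_itv/= lte_fin; case: ltP => h; first by rewrite EFinN.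
    by have -> : b = a by [apply/eqP; rewrite eq_le h]; rewrite subrr.
  by rewrite Rintegral_cst// -[fine _]/(fine (mu `[a, b])) muab mulrC.
rewrite -RintegralB//; apply: le_normr_Rintegral => //.
by apply: (@integrableB _ _ R mu _ _ _ _ intab intc).
Qed.

(** The difference quotient minus [f x] is the oriented mean of [f - f x]. *)
Lemma lebesgue_point_derivative (f : R -> R) x : 0 < x -> lebesgue_point f x ->
  derivable (oriented_integral f 0) x 1 /\
  derive1 (oriented_integral f 0) x = f x.
Proof.
move=> x0 [lf /cvgr0Pnorm_le Lf].
suff H : h^-1 *: (oriented_integral f 0 (h + x) - oriented_integral f 0 x)
    @[h --> 0^'] --> f x.
  split; last exact/cvg_lim.
  apply/cvg_ex; exists (f x).
  by under eq_fun do rewrite /= [_ *: 1]mulr1.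
apply/cvgrPdist_le => e e0; have {}Lf := Lf e e0.
near=> h.
have h0 : h != 0 by near: h; exact: nbhs_dnbhs_neq.
have hx : `|h| < x by near: h; exact: dnbhs0_lt.
have hp : 0 < `|h| by rewrite normr_gt0.
apply: (@le_trans _ _ `|h^-1 * oriented_integral (fun t => `|f t - f x|) x (x + h)|);
  last by near: h.
rewrite oriented_integral_norm// distrC.
rewrite [h^-1 *: _]/(h^-1 * _) (addrC h).
have -> : h^-1 * (oriented_integral f 0 (x + h) - oriented_integral f 0 x) - f x =
  h^-1 * (oriented_integral f 0 (x + h) - oriented_integral f 0 x - h * f x).
  by field.
rewrite normrM normfV ler_wpM2l ?invr_ge0//.
have [xh|xh] := leP x (x + h).
  have := integral_increment f (f x) x (x + h) lf (ltW x0) xh.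
  by rewrite (addrC x h) addrK.
have xh0 : 0 <= x + h by move: hx; rewrite ltr_norml => /andP[? ?]; lra.
have := integral_increment f (f x) (x + h) x lf xh0 (ltW xh).
by rewrite -normrN; congr (`|_| <= _); ring.
Unshelve. all: by end_near. Qed.

End lebesgue_points.

Theorem proposition12 (R : realType) :
  (forall x : R, wilton_number x -> lebesgue_point (@wilton R) x) /\
  (forall x : R, 0 < x < 1 -> wilton_number x ->
    derivable (@Upsilon R) x 1 /\ derive1 (@Upsilon R) x = wilton x).
Proof.
split=> [x|x /andP[x0 _]] wx; first exact: lebesgue_point_wilton.
exact: (lebesgue_point_derivative (@wilton R) x x0 (lebesgue_point_wilton x wx)).
Qed.
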